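(* Assume that condition $\mathbf{(H)}$ holds. Then the (mild) solutions of $$u'(t)=\mathcal{A}u(t)+F(t,u(t)),\quad t\ge 0,\qquad u(0)=u_0,$$ starting from $u_0\in(\mathbb{L}^2(\Omega))^s_+$ remain in $(\mathbb{L}^2(\Omega))^s_+$; that is, if $u_0\in(\mathbb{L}^2(\Omega))^s_+$ then $u(t)\in(\mathbb{L}^2(\Omega))^s_+$ for all $t\ge0$.
   Context: Setting. $\Omega\subset\mathbb{R}^m$ is a bounded open set, $m\in\{1,2,3\}$; $s,r\in\mathbb{N}^*$; $k_1,\dots,k_m,u_1,\dots,u_m$ are positive constants. The real Hilbert lattice $(\mathbb{L}^2(\Omega))^s$ has norm $\|z\|=\big(\sum_{j=1}^s\|z_j\|_{\mathbb{L}^2(\Omega)}^2\big)^{1/2}$, the componentwise a.e. order, and positive cone $(\mathbb{L}^2(\Omega))^s_+=\{z\in(\mathbb{L}^2(\Omega))^s: z_j\ge0,\ j=1,\dots,s\}$. Operator. $\mathcal{A}:(H_0^1(\Omega)\cap H^2(\Omega))^s\to(\mathbb{L}^2(\Omega))^s$ is defined by $(\mathcal{A}z)(x)=\sum_{i=1}^m\big(k_i\frac{\partial^2 z(x)}{\partial x_i^2}-u_i\frac{\partial z(x)}{\partial x_i}\big)$ (acting componentwise); it generates a $C_0$-semigroup $(S(t))_{t\ge0}$ on $(\mathbb{L}^2(\Omega))^s$. Reaction term. For $\kappa=1,\dots,r$ and $j=1,\dots,s$, $l_{j\kappa},r_{j\kappa}\in\mathbb{N}$ are non-negative integers, and $h_\kappa:[0,\infty)\to\mathbb{R}$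 is almost everywhere continuous with $0\le h_\kappa(t)\le d_\kappa$ for all $t\ge0$, for some constant $d_\kappa>0$. For $t\ge 0$, $F(t,z)=(F_1(t,z),\dots,F_s(t,z))$ with $$F_j(t,z)(x)=\sum_{\kappa=1}^r(r_{j\kappa}-l_{j\kappa})h_\kappa(t)\prod_{\nu=1}^s(z_\nu(x))^{l_{\nu\kappa}},\qquad x\in\Omega$$ (with the convention $y^0=1$). Condition $\mathbf{(H)}$: for each $\kappa\in\{1,\dots,r\}$, either $l_{j\kappa}=0$ for all $j\in\{1,\dots,s\}$, or there exists a unique $j_0\in\{1,\dots,s\}$ such that $l_{j_0\kappa}=1$ and $l_{j\kappa}=0$ for all $j\ne j_0$. Under $\mathbf{(H)}$, $F(t,z)$ is defined for all $z\in(\mathbb{L}^2(\Omega))^s$. Mild solution. $u:[0,+\infty)\to(\mathbb{L}^2(\Omega))^s$ is the (global) mild solution with initial value $u_0$ if $u(t)=S(t)u_0+\int_0^tS(t-\tau)F(\tau,u(\tau))\,d\tau$ for all $t\ge0$. Under $\mathbf{(H)}$, it exists and is unique for every $u_0\in(\mathbb{L}^2(\Omega))^s$. *)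

(* Defs.v *)
From HB Require Import structures.
From mathcomp Require Import all_boot all_order all_algebra.
From mathcomp Require Import all_classical all_reals all_analysis.
From mathcomp Require Import ring lra.

Set Implicit Arguments.
Unset Strict Implicit.
Unset Printing Implicit Defensive.

Import Order.TTheory GRing.Theory Num.Theory.
Import numFieldNormedType.Exports.

Local Open Scope classical_set_scope.
Local Open Scope ring_scope.

Section measurable_rV.
Context {R : realType} (m : nat).

Let coors : 'I_m -> 'rV[R]_m -> measurableTypeR R := fun i x => x 0 i.

Let rV_set0 : g_sigma_preimage coors set0.
Proof. exact: sigma_algebra0. Qed.

Let rV_setC A : g_sigma_preimage coors A -> g_sigma_preimage coors (~` A).
Proof. exact: sigma_algebraC. Qed.

Let rV_bigcup (F : _^nat) : (forall i, g_sigma_preimage coors (F i)) ->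
  g_sigma_preimage coors (\bigcup_i (F i)).
Proof. exact: sigma_algebra_bigcup. Qed.

(* The sigma-algebra generated by the coordinates; it contains the open sets
   (open_measurable_rV), hence is the Borel one. *)
HB.instance Definition _ :=
  @isMeasurable.Build default_measure_display
  'rV[R]_m (g_sigma_preimage coors) rV_set0 rV_setC rV_bigcup.

Lemma measurable_rV_coord (i : 'I_m) :
  measurable_fun setT (fun x : 'rV[R]_m => x 0 i : measurableTypeR R).
Proof.
move=> _ Y mY; rewrite setTI; apply: sub_sigma_algebra => /=.
rewrite -bigcup_seq/=; exists i => /=; first by rewrite mem_index_enum.
by exists Y => //; rewrite setTI.
Qed.

Lemma measurable_fun_rV d (T : measurableType d) (f : T -> 'rV[R]_m) :
  (forall i, measurable_fun setT (fun t => f t 0 i : measurableTypeR R)) ->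
  measurable_fun setT f.
Proof.
move=> mf.
have mfS : g_sigma_preimage (fun i => coors i \o f) `<=` measurable.
  apply: smallest_sub; first exact: sigma_algebra_measurable.
  rewrite -bigcup_seq; apply: bigcup_sub => i _ A [B mB <-].
  exact: (mf i).
move=> _ A mA; apply: mfS; rewrite g_sigma_preimage_comp.
by exists A.
Qed.

Lemma open_measurable_rV (U : set 'rV[R]_m) : open U -> measurable U.
Proof.
move=> oU.
pose box (ab : 'rV[rat]_m * 'rV[rat]_m) : set 'rV[R]_m :=
  [set x | forall i, ratr (ab.1 0 i) < x 0 i < ratr (ab.2 0 i)].
have mbox ab : measurable (box ab).
  have -> : box ab = \bigcap_(i in [set: 'I_m])
      ((fun x : 'rV[R]_m => x 0 i) @^-1` `]ratr (ab.1 0 i), ratr (ab.2 0 i)[).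
    apply/seteqP; split=> x /= Hx.
      by move=> i _ /=; rewrite in_itv /= Hx.
    by move=> i; have := Hx i I; rewrite /= in_itv.
  apply: fin_bigcap_measurable; first exact: finite_finset.
  move=> i _; rewrite -[X in measurable X]setTI.
  by apply: measurable_rV_coord => //; exact: measurable_itv.
have -> : U = \bigcup_ab (if `[< box ab `<=` U >] then box ab else set0).
  apply/seteqP; split=> [x Ux|x [ab _]]; last by case: asboolP => // sU bx; exact: sU.
  have /nbhs_ballP[e /= e0 xeU] : nbhs x U by exact: open_nbhs_nbhs.
  have /choice[a Ha] (i : 'I_m) : exists q : rat,
      ratr q \in `]x 0 i - e, x 0 i[.
    by apply: rat_in_itvoo; rewrite ltrBlDr ltrDl.
  have /choice[b Hb] (i : 'I_m) : exists q : rat,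
      ratr q \in `]x 0 i, x 0 i + e[.
    by apply: rat_in_itvoo; rewrite ltrDl.
  exists (\row_i a i, \row_i b i) => //.
  case: asboolP => [_ i /=|[]].
    by rewrite !mxE; have := Ha i; have := Hb i; rewrite !in_itv/=
      => /andP[-> _] /andP[_ ->].
  move=> y /= Hy; apply: xeU; split => // i j; rewrite ord1.
  have := Hy j; rewrite !mxE; have := Ha j; have := Hb j; rewrite !in_itv/=.
  move=> /andP[_ bx] /andP[xa _] /andP[ay yb].
  rewrite /ball /= /ball_ /= ltr_distlC; apply/andP; split.
    exact: lt_trans ay.
  exact: lt_trans bx.
apply: countable_bigcupT_measurable; first exact: countableP.
by move=> ab; case: ifP.
Qed.

End measurable_rV.

Section lebesgue_rV.
Context {R : realType}.

Definition cons_rV (m : nat) (p : R * 'rV[R]_m) : 'rV[R]_m.+1 :=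
  row_mx (p.1%:M : 'rV_1) p.2.

Lemma measurable_cons_rV m :
  measurable_fun setT (@cons_rV m : measurableTypeR R * 'rV[R]_m -> _).
Proof.
apply: measurable_fun_rV => i; rewrite /cons_rV.
case: (@split_ordP 1 m i) => j ->.
  under eq_fun do rewrite (@row_mxEl _ 1 1 m) mxE ord1 eqxx mulr1n.
  exact: measurable_fst.
under eq_fun do rewrite (@row_mxEr _ 1 1 m).
exact: (measurableT_comp (measurable_rV_coord j) measurable_snd).
Qed.

Section cons_measure.
Context (m : nat) (mu : {sigma_finite_measure set 'rV[R]_m -> \bar R}).

Definition cons_measure : set 'rV[R]_m.+1 -> \bar R :=
  pushforward (@lebesgue_measure R \x mu)%E (@cons_rV m).

Let cons_measure0 : cons_measure set0 = 0%E.
Proof. by rewrite /cons_measure /pushforward preimage_set0 measure0. Qed.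

Let cons_measure_ge0 A : (0 <= cons_measure A)%E.
Proof. by apply: integral_ge0 => x _ /=; exact: measure_ge0. Qed.

Let cons_measure_sigma_additive : semi_sigma_additive cons_measure.
Proof.
have mc := @measurable_cons_rV m.
move=> F mF tF mUF; rewrite /cons_measure /pushforward preimage_bigcup.
apply: measure_semi_sigma_additive.
- by move=> n; rewrite -[X in measurable X]setTI; exact: mc.
- apply/trivIsetP => /= i j _ _ ij; rewrite -preimage_setI.
  by move/trivIsetP : tF => /(_ _ _ _ _ ij) ->//; rewrite preimage_set0.
- by rewrite -preimage_bigcup -[X in measurable X]setTI; exact: mc.
Qed.

HB.instance Definition _ := isMeasure.Build _ _ _ cons_measure
  cons_measure0 cons_measure_ge0 cons_measure_sigma_additive.

Let cons_measure_sigma_finite : sigma_finite setT cons_measure.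
Proof.
have /sigma_finiteP[F [TF ndF Foo]] := sigma_finiteT (@lebesgue_measure R).
have /sigma_finiteP[G [TG ndG Goo]] := sigma_finiteT mu.
pose H n := F n `*` G n.
have TH : \bigcup_n H n = setT.
  apply/seteqP; split=> // -[a y] _.
  have [n _ Fa] : (\bigcup_n F n) a by rewrite -TF.
  have [k _ Gy] : (\bigcup_n G n) y by rewrite -TG.
  exists (maxn n k) => //; split => /=.
    by move: a Fa; exact/subsetPset/ndF/leq_maxl.
  by move: y Gy; exact/subsetPset/ndG/leq_maxr.
have Hoo n : measurable (H n) /\ ((@lebesgue_measure R \x mu) (H n) < +oo)%E.
  have [mF Fy] := Foo n; have [mG Gy] := Goo n.
  split; first exact: measurableX.
  by rewrite product_measure1E// lte_mul_pinfty// ge0_fin_numE.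
pose uncons (x : 'rV[R]_m.+1) : measurableTypeR R * 'rV[R]_m :=
  (x 0 0, @rsubmx R 1 1 m x).
have muncons : measurable_fun setT uncons.
  apply: measurable_fun_pair; first exact: measurable_rV_coord.
  apply: measurable_fun_rV => i.
  under eq_fun do rewrite mxE.
  exact: measurable_rV_coord.
have consK p : uncons (@cons_rV m p) = p.
  case: p => a y; rewrite /uncons /cons_rV (@row_mxKr _ 1 1 m); congr pair.
  have -> : 0 = @lshift 1 m 0 :> 'I_m.+1 by exact: val_inj.
  by rewrite (@row_mxEl _ 1 1 m) mxE eqxx.
exists (fun n => uncons @^-1` H n).
  by rewrite -preimage_bigcup TH.
move=> n; have [mH ?] := Hoo n; split.
  by rewrite -[X in measurable X]setTI; exact: muncons.
rewrite /cons_measure /pushforward -comp_preimage.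
by rewrite (_ : uncons \o _ = id) // funeqE => p /=; rewrite consK.
Qed.

HB.instance Definition _ := Measure_isSigmaFinite.Build _ _ _ cons_measure
  cons_measure_sigma_finite.

End cons_measure.

Fixpoint lebesgue_rV (m : nat) : {sigma_finite_measure set 'rV[R]_m -> \bar R} :=
  match m with
  | 0 => @dirac _ 'rV[R]_0 0 R
  | m'.+1 => cons_measure (lebesgue_rV m')
  end.

End lebesgue_rV.

Section Lp.
Local Open Scope quotient_scope.
Context d (T : measurableType d) (R : realType).
Variables (mu : {measure set T -> \bar R}) (p : \bar R) (p1 : (1 <= p)%E).

Definition Lp_seminorm (f : LfunType mu p1) : R := fine ('N[mu]_p[EFin \o f])%E.
Local Notation nm := Lp_seminorm.

Lemma Lp_seminormZ a (f : LfunType mu p1) : nm (a *: f) = `|a| * nm f.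
Proof.
by apply/EFin_inj; rewrite EFinM !finite_norm_fine -LnormZ.
Qed.

Lemma Lp_seminormD (f g : LfunType mu p1) : nm (f + g) <= nm f + nm g.
Proof. exact: ler_LnormD. Qed.

Lemma Lp_seminorm_ge0 (f : LfunType mu p1) : 0 <= nm f.
Proof. by rewrite fine_ge0 // Lnorm_ge0. Qed.

Lemma Lp_seminorm0 : nm 0 = 0.
Proof. by rewrite -(scale0r 0) Lp_seminormZ normr0 mul0r. Qed.

(* The library's LspaceType carries neither an algebraic structure nor a norm;
   here L^p is the quotient of the p-integrable functions by the functions of
   zero seminorm, as a normed module. *)
Definition Lp_null : {pred LfunType mu p1} := [pred f | nm f == 0].

Lemma Lp_null_zmod_closed : zmod_closed Lp_null.
Proof.
split=> [|f g]; rewrite !inE.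
  by rewrite Lp_seminorm0.
move=> /eqP f0 /eqP g0; rewrite eq_le Lp_seminorm_ge0 andbT.
rewrite (le_trans (Lp_seminormD _ _))// -scaleN1r Lp_seminormZ f0 g0.
by rewrite mulr0 addr0.
Qed.

HB.instance Definition _ :=
  GRing.isZmodClosed.Build _ Lp_null Lp_null_zmod_closed.

Definition Lp : Type := Quotient.quot Lp_null.
Local Notation Q := (Quotient.quot Lp_null).
HB.instance Definition _ := GRing.Zmodule.on Lp.

Definition Lp_class (f : LfunType mu p1) : Lp := \pi_Q f.
Definition Lp_repr (z : Lp) : LfunType mu p1 := repr (z : Q).

Lemma Lp_reprK : cancel Lp_repr Lp_class.
Proof. exact: reprK. Qed.

Lemma Lp_classP (f g : LfunType mu p1) :
  Lp_class f = Lp_class g <-> nm (f - g) = 0.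
Proof.
split=> [/eqP|fg0]; first by rewrite -Quotient.idealrBE inE => /eqP.
by apply/eqP; rewrite -Quotient.idealrBE inE fg0.
Qed.

Lemma Lp_classD (f g : LfunType mu p1) :
  Lp_class (f + g) = Lp_class f + Lp_class g.
Proof. exact: (raddfD \pi_Q). Qed.

Lemma Lp_class0 : Lp_class 0 = 0.
Proof. by apply: (addIr (Lp_class 0)); rewrite -Lp_classD !add0r. Qed.

Lemma Lp_seminorm_repr (f : LfunType mu p1) : nm (Lp_repr (Lp_class f)) = nm f.
Proof.
have le f' g' : Lp_class f' = Lp_class g' -> nm f' <= nm g'.
  move=> /Lp_classP fg0; rewrite -[f'](subrK g').
  by rewrite (le_trans (Lp_seminormD _ _))// fg0 add0r.
by apply/eqP; rewrite eq_le !le ?Lp_reprK.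
Qed.

Definition Lp_scale (a : R) (z : Lp) : Lp := Lp_class (a *: Lp_repr z).

Lemma Lp_classZ a (f : LfunType mu p1) :
  Lp_class (a *: f) = Lp_scale a (Lp_class f).
Proof.
apply/Lp_classP; rewrite -scalerBr Lp_seminormZ.
have /Lp_classP -> : Lp_class f = Lp_class (Lp_repr (Lp_class f)).
  by rewrite Lp_reprK.
by rewrite mulr0.
Qed.

Let scaleA a b z : Lp_scale a (Lp_scale b z) = Lp_scale (a * b) z.
Proof. by rewrite -[z]Lp_reprK -!Lp_classZ scalerA. Qed.

Let scale1 : left_id 1 Lp_scale.
Proof. by move=> z; rewrite -[z]Lp_reprK -Lp_classZ scale1r. Qed.

Let scaleDr : right_distributive Lp_scale +%R.
Proof.
move=> a y z; rewrite -[y]Lp_reprK -[z]Lp_reprK -Lp_classD -!Lp_classZ.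
by rewrite scalerDr Lp_classD.
Qed.

Let scaleDl z : {morph Lp_scale^~ z : a b / a + b}.
Proof.
by move=> a b; rewrite -[z]Lp_reprK -!Lp_classZ scalerDl Lp_classD.
Qed.

HB.instance Definition _ :=
  GRing.Zmodule_isLmodule.Build R Lp scaleA scale1 scaleDr scaleDl.

Definition Lp_norm (z : Lp) : R := Lp_seminorm (Lp_repr z).

Let Lp_normD y z : Lp_norm (y + z) <= Lp_norm y + Lp_norm z.
Proof.
rewrite -[y]Lp_reprK -[z]Lp_reprK -Lp_classD /Lp_norm !Lp_seminorm_repr.
exact: Lp_seminormD.
Qed.

Let Lp_normZ a z : Lp_norm (a *: z) = `|a| * Lp_norm z.
Proof. by rewrite /Lp_norm Lp_seminorm_repr Lp_seminormZ. Qed.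

Let Lp_norm0_eq0 z : Lp_norm z = 0 -> z = 0.
Proof.
move=> z0; rewrite -[z]Lp_reprK -[0]Lp_reprK; apply/Lp_classP/eqP.
rewrite eq_le Lp_seminorm_ge0 andbT (le_trans (Lp_seminormD _ _))//.
rewrite -scaleN1r Lp_seminormZ -[nm (_ z)]/(Lp_norm z) z0 add0r normrN1 mul1r.
by rewrite -Lp_class0 Lp_seminorm_repr Lp_seminorm0.
Qed.

HB.instance Definition _ :=
  Lmodule_isNormed.Build R Lp Lp_normD Lp_normZ Lp_norm0_eq0.

Lemma Lp_normE (z : Lp) : `|z| = fine ('N[mu]_p[EFin \o Lp_repr z])%E.
Proof. by []. Qed.

End Lp.

Section euclidean_sum.
Context (R : realType) (V : normedModType R) (s : nat).

(* V^s with the Euclidean (Hilbert sum) norm instead of the sup norm. *)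
Definition hsum : Type := {ffun 'I_s -> V}.
HB.instance Definition _ := GRing.Lmodule.on hsum.

Definition hsum_norm (z : hsum) : R := Num.sqrt (\sum_(j < s) `|z j| ^+ 2).

Let hsum_normZ a z : hsum_norm (a *: z) = `|a| * hsum_norm z.
Proof.
rewrite /hsum_norm -[X in X * _]sqrtr_sqr -sqrtrM ?sqr_ge0// mulr_sumr.
congr Num.sqrt; apply: eq_bigr => j _.
by rewrite ffunE normrZ exprMn real_normK ?num_real.
Qed.

Let hsum_norm0_eq0 z : hsum_norm z = 0 -> z = 0.
Proof.
move/eqP; rewrite sqrtr_eq0 => z0; apply/ffunP => j; rewrite ffunE.
have := z0; rewrite (bigD1 j)//= => zj0; apply/eqP.
rewrite -normr_eq0 -sqrf_eq0 eq_le sqr_ge0 andbT.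
by rewrite (le_trans _ zj0)// lerDl sumr_ge0// => i _; exact: sqr_ge0.
Qed.

(* Minkowski's inequality for finite sums, via Cauchy-Schwarz in the form
   2ab <= ca^2 + b^2/c. *)
Let hsum_normD y z : hsum_norm (y + z) <= hsum_norm y + hsum_norm z.
Proof.
have [/hsum_norm0_eq0 ->|y0] := eqVneq (hsum_norm y) 0.
  by rewrite add0r lerDr sqrtr_ge0.
have [/hsum_norm0_eq0 ->|z0] := eqVneq (hsum_norm z) 0.
  by rewrite addr0 lerDl sqrtr_ge0.
have ge0 w : 0 <= hsum_norm w by exact: sqrtr_ge0.
have sq w : hsum_norm w ^+ 2 = \sum_(j < s) `|w j| ^+ 2.
  by rewrite sqr_sqrtr// sumr_ge0// => i _; exact: sqr_ge0.
rewrite -ler_sqr ?nnegrE ?addr_ge0// sq.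
set a := hsum_norm y in y0 *; set b := hsum_norm z in z0 *.
have a0 : 0 < a by rewrite lt_def y0 ge0.
have b0 : 0 < b by rewrite lt_def z0 ge0.
apply: (@le_trans _ _ (\sum_(j < s) ((1 + b / a) * `|y j| ^+ 2
                                    + (1 + a / b) * `|z j| ^+ 2))).
  apply: ler_sum => j _; rewrite ffunE.
  apply: (@le_trans _ _ ((`|y j| + `|z j|) ^+ 2)).
    by rewrite ler_sqr ?nnegrE ?addr_ge0// ler_normD.
  rewrite -subr_ge0.
  have -> : (1 + b / a) * `|y j| ^+ 2 + (1 + a / b) * `|z j| ^+ 2
      - (`|y j| + `|z j|) ^+ 2 = (b * `|y j| - a * `|z j|) ^+ 2 / (a * b).
    by field; rewrite y0 z0.
  by rewrite divr_ge0 ?sqr_ge0// mulr_ge0// ltW.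
rewrite big_split/= -!mulr_sumr -!sq -/a -/b.
by rewrite le_eqVlt; apply/orP; left; apply/eqP; field; rewrite y0 z0.
Qed.

HB.instance Definition _ :=
  Lmodule_isNormed.Build R hsum hsum_normD hsum_normZ hsum_norm0_eq0.

Lemma hsum_normE (z : hsum) : `|z| = Num.sqrt (\sum_(j < s) `|z j| ^+ 2).
Proof. by []. Qed.

End euclidean_sum.

Section semigroups.
Context (R : realType) (V : normedModType R).

Definition C0_semigroup (S : R -> V -> V) : Prop :=
  [/\ forall t, 0 <= t -> linear (S t) /\ continuous (S t),
      forall z, S 0 z = z,
      forall t t' z, 0 <= t -> 0 <= t' -> S (t + t') z = S t (S t' z) &
      forall z, S t z @[t --> 0^'+] --> z].

(* A, with domain D, is the infinitesimal generator of S. *)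
Definition generates (D : set V) (A : V -> V) (S : R -> V -> V) : Prop :=
  forall z w, ((t^-1 *: (S t z - z)) @[t --> 0^'+] --> w) <->
              (D z /\ w = A z).

End semigroups.

Section bochner.
Context d (T : measurableType d) (R : realType) (V : normedModType R).
Variables (mu : {measure set T -> \bar R}) (D : set T).

Record simple_fun := SimpleFun {
  sf_size : nat ;
  sf_set : 'I_sf_size -> set T ;
  sf_val : 'I_sf_size -> V ;
  sf_measurable : forall i, measurable (sf_set i) ;
  sf_finite : forall i, (mu (sf_set i `&` D) < +oo)%E }.

Arguments sf_set : clear implicits.
Arguments sf_val : clear implicits.

Definition sf_eval (s : simple_fun) (x : T) : V :=
  \sum_i (\1_(sf_set s i) x : R) *: sf_val s i.

Definition sf_integral (s : simple_fun) : V :=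
  \sum_i fine (mu (sf_set s i `&` D)) *: sf_val s i.

(* The Bochner integral of f over D exists and equals v: f is a.e. the limit of
   an L^1-Cauchy sequence of simple functions whose integrals converge to v.
   Almost everywhere convergence, rather than everywhere, lets f be measurable
   for the completion of mu only. *)
Definition is_bochner_integral (f : T -> V) (v : V) : Prop :=
  exists s : nat -> simple_fun,
  [/\ {ae mu, forall x, D x -> sf_eval (s n) x @[n --> \oo] --> f x},
      forall e : R, 0 < e -> exists N, forall n n', (N <= n)%N -> (N <= n')%N ->
        (\int[mu]_(x in D) (`|sf_eval (s n) x - sf_eval (s n') x|)%:E < e%:E)%E &
      sf_integral (s n) @[n --> \oo] --> v].

End bochner.

(* Continuity of u is part of the usual notion of mild solution. *)
Definition mild_solution (R : realType) (V : normedModType R)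
    (S : R -> V -> V) (F : R -> V -> V) (u0 : V) (u : R -> V) : Prop :=
  {within `[0, +oo[%classic, continuous u} /\
  forall t, 0 <= t -> exists2 v,
    is_bochner_integral (@lebesgue_measure R) `[0, t]%classic
      (fun tau => S (t - tau) (F tau (u tau))) v &
    u t = S t u0 + v.

Section sobolev.
Context (R : realType) (m : nat) (Om : set 'rV[R]_m) (oOm : open Om).
Implicit Type phi : 'rV[R]_m -> R.

(* Lebesgue measure on Om, as a measure on the whole space that ignores the
   complement of Om: functions on Om are functions on 'rV[R]_m modulo their
   values outside Om. *)
Definition lebesgue_on : {measure set 'rV[R]_m -> \bar R} :=
  mrestr (lebesgue_rV m) (open_measurable_rV oOm).

Definition L2 : normedModType R := Lp lebesgue_on (lee1n 2).

(* Equal to 0 when phi is not square integrable on Om. *)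
Definition toL2 phi : L2 :=
  Lp_class (insubd (0 : LfunType lebesgue_on (lee1n 2)) phi).

Definition pderiv (i : 'I_m) phi : 'rV[R]_m -> R := 'D_(delta_mx 0 i) phi.

Definition smooth phi : Prop := forall al : seq 'I_m,
  continuous (foldr pderiv phi al) /\
  forall i x, derivable (foldr pderiv phi al) x (delta_mx 0 i).

Definition test_function phi : Prop :=
  [/\ smooth phi, compact (closure [set x | phi x != 0]) &
      closure [set x | phi x != 0] `<=` Om].

Definition is_weak_deriv (i : 'I_m) (z w : L2) : Prop :=
  forall phi, test_function phi ->
    \int[lebesgue_on]_x (Lp_repr z x * pderiv i phi x) =
    - \int[lebesgue_on]_x (Lp_repr w x * phi x).

(* Weak derivatives are unique as elements of L^2; the default value 0 is only
   taken when there is none. *)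
Definition weak_deriv (i : 'I_m) (z : L2) : L2 :=
  xget 0 [set w | is_weak_deriv i z w].

Definition H1 : set L2 := [set z | forall i, exists w, is_weak_deriv i z w].

Definition H2 : set L2 := [set z | H1 z /\ forall i, H1 (weak_deriv i z)].

(* The closure of the test functions for the H^1 norm. *)
Definition H10 : set L2 := [set z | H1 z /\
  exists phi : nat -> 'rV[R]_m -> R,
  [/\ forall n, test_function (phi n),
      toL2 (phi n) @[n --> \oo] --> z &
      forall i, toL2 (pderiv i (phi n)) @[n --> \oo] --> weak_deriv i z]].

End sobolev.

Section reaction_convection_diffusion.
Context (R : realType) (m : nat) (Om : set 'rV[R]_m) (oOm : open Om).
Context (s r : nat).

Definition L2s : normedModType R := hsum (L2 oOm) s.

Definition L2s_cone : set L2s :=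
  [set z | forall j, {ae lebesgue_on oOm, forall x, 0 <= Lp_repr (z j) x}].

Definition opA_domain : set L2s :=
  [set z | forall j, (H10 (oOm := oOm) `&` H2 (oOm := oOm)) (z j)].

Definition opA (k u : 'I_m -> R) (z : L2s) : L2s :=
  [ffun j => \sum_i (k i *: weak_deriv i (weak_deriv i (z j))
                     - u i *: weak_deriv i (z j))].

(* l and q are the families l_{j kappa} and r_{j kappa}; x ^+ 0 = 1 for all x. *)
Definition reaction (l q : 'I_s -> 'I_r -> nat) (h : 'I_r -> R -> R)
    (t : R) (z : L2s) : L2s :=
  [ffun j => toL2 oOm (fun x =>
    \sum_kappa ((q j kappa)%:R - (l j kappa)%:R) * h kappa t *
      \prod_nu Lp_repr (z nu) x ^+ l nu kappa)].

Definition condition_H (l : 'I_s -> 'I_r -> nat) : Prop :=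
  forall kappa, (forall j, l j kappa = 0%N) \/
    exists! j0, l j0 kappa = 1%N /\ forall j, j != j0 -> l j kappa = 0%N.

End reaction_convection_diffusion.

(* Main.v *)
(* Let n(z) be the norm of the negative part z^- in the Hilbert space L^2(Om)^s.
   A bound on the right Dini derivative of n along a trajectory gives, by a
   Gronwall argument, n = 0 for all times as soon as n = 0 initially.

   The semigroup. Composing the test functions that approximate z in H^1_0 with
   smooth functions G tending to x |-> -x^- gives test functions, so that the
   definition of weak derivatives bounds <A z, -z^-> by a multiple of n(z)^2:
   the second order terms have the sign of -G' <= 0 and absorb the convection terms
   by Young's inequality. Neither the weak differentiability of z^- nor an
   integration by parts formula is needed. As S h z - z - h A (S h z) = o(h) on
   the domain, which is dense, n(S t z) <= e^(Ct) n(z).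

   The mild solution. Under condition (H) the map F(t, .) + lam is affine and
   maps the cone into itself, hence n(F(t, z) + lam z) <= K n(z). Pairing
   y(t+h) = S h (y t) + \int_t^(t+h) S (t+h-s) F(s, y s) ds
   with the negative part of y(t+h) turns this into the Dini bound
   n(y (t+h)) <= n(y t) + h (C n(y t) + o(1)). *)
Require Import Defs.
From HB Require Import structures.
From mathcomp Require Import all_boot all_order all_algebra.
From mathcomp Require Import all_classical all_reals all_analysis.
From mathcomp Require Import measurable_realfun ring lra.

Import Order.TTheory GRing.Theory Num.Theory.
Import numFieldNormedType.Exports.

Local Open Scope classical_set_scope.
Local Open Scope ring_scope.
Set Implicit Arguments.
Unset Strict Implicit.
Unset Printing Implicit Defensive.
(** * A Gronwall lemma for Dini derivatives *)

Section dini.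
Context {R : realType}.

Lemma dini_gronwall (f : R -> R) (C : R) : 0 <= C -> 0 <= f 0 ->
  (forall t : R, 0 < t -> f s @[s --> t^'-] --> f t) ->
  (forall t : R, 0 <= t -> forall e : R, 0 < e ->
    \forall h \near 0^'+, f (t + h) <= f t + h * (C * f t + e)) ->
  forall t : R, 0 <= t -> f t <= expR (C * t) * f 0.
Proof.
move=> C0 f0 fl fr t t0.
have lim_phi : expR ((C + e) * t) * (f 0 + e) @[e --> 0^'+]
    --> expR (C * t) * f 0.
  apply: cvg_at_right_filter.
  rewrite -[in X in _ --> X](addr0 C) -[in X in _ --> X](addr0 (f 0)).
  apply: cvgM; last by apply: cvgD; [exact: cvg_cst|exact: cvg_id].
  apply: continuous_cvg; first exact: continuous_expR.
  apply: cvgM; last exact: cvg_cst.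
  by apply: cvgD; [exact: cvg_cst|exact: cvg_id].
apply: (cvgr_to_ge lim_phi); near=> e.
have e0 : 0 < e by near: e; exact: nbhs_right_gt.
pose phi s := expR ((C + e) * s) * (f 0 + e).
have phi_gt0 s : 0 < phi s by rewrite mulr_gt0 ?expR_gt0 ?ltr_wpDl.
have phi_cont : continuous phi.
  move=> s; apply: cvgM; last exact: cvg_cst.
  apply: continuous_cvg; first exact: continuous_expR.
  by apply: cvgM; [exact: cvg_cst|exact: cvg_id].
pose E := [set s : R | 0 <= s <= t /\ forall q : R, 0 <= q <= s -> f q <= phi q].
have E0 : E 0.
  split; first by rewrite lexx t0.
  move=> q q0; have -> : q = 0 by apply/eqP; rewrite eq_le andbC.
  by rewrite /phi mulr0 expR0 mul1r lerDl ltW.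
have supE : has_sup E by split; [exists 0|exists t => s [/andP[]]].
have sup0 : 0 <= sup E by exact: ub_le_sup supE.2 _ E0.
have supt : sup E <= t.
  by apply: ge_sup; [exists 0|move=> s [/andP[]]].
have below (q : R) : 0 <= q -> q < sup E -> f q <= phi q.
  move=> q0 /sup_gt[|s [s0t Es] qs]; first by exists 0.
  by apply: Es; rewrite q0 ltW.
have at_sup : f (sup E) <= phi (sup E).
  have [s0|s0] := eqVneq (sup E) 0.
    by rewrite s0; apply: E0.2; rewrite lexx.
  have {s0} s0 : 0 < sup E by rewrite lt_def s0.
  have lim_d : phi s - f s @[s --> (sup E)^'-] --> phi (sup E) - f (sup E).
    apply: cvgB; last exact: fl.
    by apply: cvg_at_left_filter; exact: phi_cont.
  rewrite -subr_ge0; apply: (cvgr_to_ge lim_d).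
  near=> s; rewrite subr_ge0; apply: below.
    by near: s; exact: nbhs_left_ge.
  by near: s; exact: nbhs_left_lt.
have [st|ts] := ltP (sup E) t; last first.
  by have -> : t = sup E; [apply/eqP; rewrite eq_le ts|].
have ep : 0 < e * phi (sup E) by rewrite mulr_gt0.
have : \forall h \near 0^'+, forall k : R, 0 < k <= h ->
    f (sup E + k) <= phi (sup E + k).
  have /nbhs_ballP[d /= d0 Hd] := fr _ sup0 _ ep.
  near=> h => k /andP[k0 kh].
  have hd : h < d by near: h; exact: nbhs_right_lt.
  have kd : ball 0 d k.
    by rewrite /ball/= sub0r normrN gtr0_norm// (le_lt_trans kh).
  apply: le_trans (Hd _ kd k0) _.
  rewrite [leRHS](_ : _ = expR ((C + e) * k) * phi (sup E)); last first.
    by rewrite /phi (mulrDr (C + e)) expRD mulrCA mulrA.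
  apply: (@le_trans _ _ ((1 + (C + e) * k) * phi (sup E))); last first.
    by rewrite ler_pM2r// expR_ge1Dx.
  have : C * f (sup E) <= C * phi (sup E) by rewrite ler_wpM2l.
  nra.
move=> Hs; suff : exists2 s, E s & sup E < s.
  by move=> [s Es]; rewrite ltNge => /negP[]; apply: ub_le_sup => //; exact: supE.2.
near (0:R)^'+ => h.
have h0 : 0 < h by near: h; exact: nbhs_right_gt.
exists (sup E + h); last by rewrite ltrDl.
split.
  rewrite addr_ge0 ?(ltW h0)//= -lerBrDl ltW//.
  by near: h; apply: nbhs_right_lt; rewrite subr_gt0.
move=> q /andP[q0 qh]; have [qs|] := ltP q (sup E); first exact: below.
rewrite le_eqVlt => /predU1P[<-//|sq].
have -> : q = sup E + (q - sup E) by rewrite addrC subrK.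
have Hh : forall k : R, 0 < k <= h -> f (sup E + k) <= phi (sup E + k).
  by near: h.
by apply: Hh; rewrite subr_gt0 sq lerBlDl.
Unshelve. all: by end_near. Qed.

End dini.

(** * Strongly continuous semigroups *)

Section orbits.
Context {R : realType} {V : normedModType R} {S : R -> V -> V}.

Definition cauchy_complete (W : normedModType R) : Prop :=
  forall F : set_system W, ProperFilter F -> cauchy F -> cvg F.

Lemma continuous_linear_le (W : normedModType R) (f : V -> W) :
  linear f -> continuous f ->
  exists2 M : R, 0 <= M & forall z, `|f z| <= M * `|z|.
Proof.
move=> lf cf.
pose g : {linear V -> W} := HB.pack f (GRing.isLinear.Build _ _ _ _ _ lf).
have /linear_boundedP gM := @continuous_linear_bounded _ _ _ 0 g (cf 0).
near (+oo_R : set_system R) => M; exists M.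
  by near: M; exact: nbhs_pinfty_ge.
by near: M; exact: gM.
Unshelve. all: by end_near. Qed.

Lemma C0_semigroup_bounded : cauchy_complete V -> C0_semigroup S ->
  exists2 M : R, 1 <= M & exists2 d : R, 0 < d &
    forall (t : R) (z : V), 0 <= t <= d -> `|S t z| <= M * `|z|.
Proof.
move=> cV [Slin S0 _ Sc]; apply: contrapT => Hn.
have /choice[tz Htz] (n : nat) : exists p : R * V,
    0 <= p.1 <= n.+1%:R^-1 /\ n.+1%:R * `|p.2| < `|S p.1 p.2|.
  apply: contrapT => Hn'; apply: Hn.
  exists n.+1%:R; first by rewrite ler1n.
  exists n.+1%:R^-1; first by rewrite invr_gt0.
  move=> t z tn; rewrite leNgt; apply/negP => ltz.
  by apply: Hn'; exists (t, z).
pose W : completeNormedModType R :=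
  HB.pack (NormedModule.sort V) (Uniform_isComplete.Build V cV).
pose F : set (W -> V) := [set S (tz n).1 | n in [set: nat]].
have Flin f : F f -> bounded_fun_norm f /\ linear f.
  move=> [n _ <-]; have [/andP[tn0 _] _] := Htz n.
  have [lS cS] := Slin _ tn0; split => // r.
  have [M M0 SM] := continuous_linear_le lS cS.
  by exists (M * r) => x xr; apply: le_trans (SM x) _; rewrite ler_wpM2l.
have Fpt : pointwise_bounded F.
  move=> z.
  have /cvgrPdist_lt/(_ 1 ltr01)/nbhs_ballP[d /= d0 Hd] := Sc z.
  have [N HN] : exists N, forall n, (N <= n)%N -> n.+1%:R^-1 < d.
    have /cvgrPdist_lt/(_ d d0)[N _ HN] := @cvg_harmonic R.
    by exists N => n /HN /=; rewrite sub0r normrN gtr0_norm ?invr_gt0.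
  exists (`|z| + 1 + \sum_(i < N) `|S (tz i).1 z|) => f [n _ <-].
  have [/andP[tn0 tn1] _] := Htz n.
  have [nN|Nn] := ltnP n N.
    rewrite (bigD1 (Ordinal nN))//= addrCA lerDl.
    by rewrite !addr_ge0// sumr_ge0.
  have sum0 : 0 <= \sum_(i < N) `|S (tz i).1 z| by rewrite sumr_ge0.
  have [t0|tn'] := eqVneq (tz n).1 0.
    by rewrite t0 S0; lra.
  have tpos : 0 < (tz n).1 by rewrite lt_def tn'.
  have : `|z - S (tz n).1 z| < 1.
    apply: Hd => //=; rewrite /ball/= sub0r normrN gtr0_norm//.
    by rewrite (le_lt_trans tn1)// HN.
  have : `|S (tz n).1 z| <= `|z| + `|z - S (tz n).1 z|.
    by rewrite -[S _ z in leLHS](subrKC z) (le_trans (ler_normD _ _))// distrC.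
  lra.
have [M HM] := Banach_Steinhauss Flin Fpt 1.
pose n := Num.truncn `|M|.
have [/andP[tn0 _]] := Htz n.
set t := (tz n).1 in tn0 *; set z := (tz n).2 => ltz.
have [lS _] := Slin _ tn0.
have S00 : S t 0 = 0.
  by have := lS (-1) 0 0; rewrite !scaleN1r oppr0 addr0 addNr.
have z0 : `|z| != 0.
  apply: contraTneq ltz => /normr0_eq0 ->.
  by rewrite S00 !normr0 mulr0 ltxx.
have SZ a w : S t (a *: w) = a *: S t w.
  by have := lS a w 0; rewrite !addr0 S00 addr0.
have : `|S t (`|z|^-1 *: z)| <= M.
  apply: (HM (S t)); first by exists n.
  by rewrite normrZ normrV ?unitfE// normr_id mulVf.
rewrite SZ normrZ normrV ?unitfE// normr_id mulrC ler_pdivrMr ?lt_def ?z0//=.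
apply/negP; rewrite -ltNge (le_lt_trans _ ltz)// ler_wpM2r//.
rewrite (le_trans (ler_norm _))// ltW//.
exact: truncnS_gt.
Qed.

Lemma semigroupB t x y : C0_semigroup S -> 0 <= t ->
  S t (x - y) = S t x - S t y.
Proof.
move=> [Slin _ _ _] /Slin[lS _].
by have := lS (-1) y x; rewrite !scaleN1r => lSB; rewrite addrC lSB addrC.
Qed.

Lemma semigroupD t x y : C0_semigroup S -> 0 <= t ->
  S t (x + y) = S t x + S t y.
Proof.
by move=> [Slin _ _ _] /Slin[lS _]; have := lS 1 x y; rewrite !scale1r.
Qed.

Lemma semigroupZ t a x : C0_semigroup S -> 0 <= t ->
  S t (a *: x) = a *: S t x.
Proof.
move=> CS t0; have [Slin _ _ _] := CS; have [lS _] := Slin t t0.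
have S0 : S t 0 = 0 by rewrite -[X in S t X](subrr x) semigroupB// subrr.
by have := lS a x 0; rewrite !addr0 S0 addr0.
Qed.

Lemma C0_semigroup_left (z : V) t : cauchy_complete V -> C0_semigroup S ->
  0 < t -> S s z @[s --> t^'-] --> S t z.
Proof.
move=> cV CS t0; have [Slin S0 Sadd Sc] := CS.
have [M M1 [d d0 SM]] := C0_semigroup_bounded cV CS.
pose t' := Num.max 0 (t - d); pose z' := S t' z.
have t'0 : 0 <= t' by rewrite le_max lexx.
have t't : t' < t by rewrite gt_max t0/= ltrBlDr ltrDl.
have t'd : t - d <= t' by rewrite le_max lexx orbT.
apply/cvgrPdist_le => e e0.
have e'0 : 0 < e / M by rewrite divr_gt0// (lt_le_trans ltr01).
have /cvgrPdist_lt/(_ _ e'0)/nbhs_ballP[r /= r0 Hr] := Sc z'.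
near=> s.
have st : s < t by near: s; exact: nbhs_left_lt.
have ts : t' < s by near: s; exact: nbhs_left_gt.
have rs : t - r < s by near: s; apply: nbhs_left_gt; rewrite ltrBlDr ltrDl.
have st' : 0 <= s - t' by rewrite subr_ge0 ltW.
have -> : S t z = S (s - t') (S (t - s) z').
  rewrite /z' -(Sadd (t - s)) ?subr_ge0 ?(ltW st)// -Sadd//.
    by congr (S _ z); ring.
  by rewrite addr_ge0// subr_ge0 ltW.
have -> : S s z = S (s - t') z'.
  by rewrite /z' -Sadd//; congr (S _ z); ring.
rewrite -semigroupB//; apply: le_trans (SM _ _ _) _.
  by rewrite st'/=; lra.
rewrite -ler_pdivlMl ?(lt_le_trans ltr01)// mulrC distrC ltW//.
apply: Hr; last by rewrite subr_gt0.
by rewrite /ball/= sub0r normrN gtr0_norm ?subr_gt0//; lra.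
Unshelve. all: by end_near. Qed.

End orbits.

Lemma norm_sum_nat_le {R : realType} {V : normedModType R} (F : nat -> V) m n
    (e : R) :
  (forall k, (m <= k < n)%N -> `|F k| <= e) ->
  `|\sum_(m <= k < n) F k| <= e *+ (n - m).
Proof.
move=> Fe; apply: le_trans (ler_norm_sum _ _ _) _.
by rewrite -sumr_const_nat; exact: ler_sum_nat.
Qed.

Lemma sum_nat_shift {V : zmodType} (F : nat -> V) N p :
  \sum_(0 <= k < N) F (k + p)%N - \sum_(0 <= k < N) F k =
  \sum_(0 <= k < p) (F (N + k)%N - F k).
Proof.
elim: p => [|p IH].
  rewrite [RHS]big_geq//; apply/eqP; rewrite subr_eq0; apply/eqP.
  by apply: eq_bigr => k _; rewrite addn0.
have tel : F (N + p)%N - F p =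
    \sum_(0 <= k < N) F (k + p.+1)%N - \sum_(0 <= k < N) F (k + p)%N.
  rewrite -sumrB -[F p]/(F (0 + p)%N).
  rewrite -(@telescope_sumr _ 0 N (fun k => F (k + p)%N))//.
  by apply: eq_bigr => k _; rewrite addSnnS.
by rewrite big_nat_recr//= -IH tel [RHS]addrC addrA subrK.
Qed.

Section domain_dense.
Context {R : realType} {V : normedModType R} {S : R -> V -> V}.
Hypotheses (cV : cauchy_complete V) (CS : C0_semigroup S).
Variables (M d b : R).
Hypotheses (M1 : 1 <= M) (b0 : 0 < b) (bd : b <= d).
Hypothesis SM : forall (t : R) (z : V), 0 <= t <= d -> `|S t z| <= M * `|z|.

Let avg (z : V) (N : nat) : V :=
  N%:R^-1 *: \sum_(0 <= k < N) S (k%:R * (b / N%:R)) z.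

Let SD t t' x : 0 <= t -> 0 <= t' -> S (t + t') x = S t (S t' x).
Proof. by case: CS => _ _ + _; apply. Qed.

Let step_ge0 (N : nat) : 0 <= b / N%:R.
Proof. by rewrite divr_ge0// ltW. Qed.

Let stepM (N : nat) : (0 < N)%N -> N%:R * (b / N%:R) = b.
Proof. by move=> N0; rewrite mulrCA divff ?mulr1// pnatr_eq0 -lt0n. Qed.

Let avg_close z N e : (0 < N)%N ->
  (forall t : R, 0 <= t <= b -> `|S t z - z| <= e) -> `|avg z N - z| <= e.
Proof.
move=> N0 He; have N0' : N%:R != 0 :> R by rewrite pnatr_eq0 -lt0n.
have -> : avg z N - z =
    N%:R^-1 *: \sum_(0 <= k < N) (S (k%:R * (b / N%:R)) z - z).
  rewrite sumrB scalerBr sumr_const_nat subn0 -(scaler_nat N z) scalerA.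
  by rewrite mulVf// scale1r.
rewrite normrZ normfV normr_nat ler_pdivrMl ?ltr0n//.
rewrite mulr_natl -[N in leRHS]subn0.
apply: norm_sum_nat_le => k /andP[_ kN]; apply: He.
rewrite mulr_ge0//= -[leRHS](stepM N0) ler_wpM2r// ler_nat.
exact: ltnW.
Qed.

Let avg_refine z N K e : (0 < N)%N -> (0 < K)%N ->
  (forall t : R, 0 <= t <= b / N%:R -> `|S t z - z| <= e) ->
  `|avg z (N * K) - avg z N| <= M * e.
Proof.
move=> N0 K0 He.
have N0' : N%:R != 0 :> R by rewrite pnatr_eq0 -lt0n.
have K0' : K%:R != 0 :> R by rewrite pnatr_eq0 -lt0n.
have NK0 : (0 < N * K)%N by rewrite muln_gt0 N0.
have -> : avg z (N * K) - avg z N = (N * K)%:R^-1 *: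
    \sum_(0 <= i < N) \sum_(i * K <= j < i.+1 * K)
      (S (j%:R * (b / (N * K)%:R)) z - S (i%:R * (b / N%:R)) z).
  rewrite /avg big_nat_mul.
  under [in RHS]eq_bigr do rewrite sumrB sumr_const_nat mulSn addnK.
  rewrite sumrB scalerBr; congr (_ - _).
  by rewrite sumrMnl -(scaler_nat K) scalerA natrM invfM -mulrA mulVf// mulr1.
rewrite normrZ normfV normr_nat ler_pdivrMl ?ltr0n// mulr_natl.
rewrite (mulrnA (M * e)) (mulrnAC (M * e)) -[N in leRHS]subn0.
apply: norm_sum_nat_le => i /andP[_ iN].
apply: (@le_trans _ _ (M * e *+ (i.+1 * K - i * K))); last first.
  by rewrite mulSn addnK.
apply: norm_sum_nat_le => j /andP[ij ji].
have e0 : 0 <= b / (N * K)%:R by [].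
have eK : b / N%:R = K%:R * (b / (N * K)%:R) by rewrite natrM; field; rewrite K0' N0'.
have j0 : 0 <= (j - i * K)%N%:R * (b / (N * K)%:R) by rewrite mulr_ge0.
have i0 : 0 <= i%:R * (b / N%:R) by rewrite mulr_ge0.
have -> : j%:R * (b / (N * K)%:R) =
    i%:R * (b / N%:R) + (j - i * K)%N%:R * (b / (N * K)%:R).
  by rewrite eK (mulrA i%:R) -natrM -mulrDl -natrD subnKC.
rewrite SD// -semigroupB//; apply: le_trans (SM _ _) _.
  rewrite i0 (le_trans _ bd)// -[leRHS](stepM N0) ler_wpM2r// ler_nat.
  exact: ltnW.
rewrite ler_wpM2l ?(le_trans _ M1)//; apply: He; rewrite j0 eK ler_wpM2r//.
by rewrite ler_nat leq_subLR -mulSnr ltnW.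
Qed.

Let avg_shift z N p e : (p <= N)%N -> (0 < N)%N ->
  (forall t : R, 0 <= t <= p%:R * (b / N%:R) -> `|S t z - z| <= e) ->
  `|S (p%:R * (b / N%:R)) (avg z N) - avg z N - (p%:R / N%:R) *: (S b z - z)|
    <= p%:R / N%:R * ((M + 1) * e).
Proof.
move=> pN N0 He.
have N0' : N%:R != 0 :> R by rewrite pnatr_eq0 -lt0n.
have p0 : 0 <= p%:R * (b / N%:R) by rewrite mulr_ge0.
have k0 k : 0 <= k%:R * (b / N%:R) by rewrite mulr_ge0.
have SS (F : nat -> V) n : S (p%:R * (b / N%:R)) (\sum_(0 <= k < n) F k) =
    \sum_(0 <= k < n) S (p%:R * (b / N%:R)) (F k).
  elim: n => [|n IH].
    by rewrite !big_geq// -[X in S _ X](subrr 0) semigroupB// subrr.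
  by rewrite !big_nat_recr//= -IH semigroupD.
have -> : S (p%:R * (b / N%:R)) (avg z N) - avg z N
    - (p%:R / N%:R) *: (S b z - z) = N%:R^-1 *: \sum_(0 <= k < p)
      (S b (S (k%:R * (b / N%:R)) z - z) - (S (k%:R * (b / N%:R)) z - z)).
  rewrite /avg semigroupZ// SS.
  under eq_bigr do rewrite -SD// -mulrDl -natrD addnC.
  rewrite -scalerBr (@sum_nat_shift _ (fun k => S (k%:R * (b / N%:R)) z)).
  rewrite [p%:R / _]mulrC -scalerA -scalerBr; congr (_ *: _).
  have -> : p%:R *: (S b z - z) = \sum_(0 <= k < p) (S b z - z).
    by rewrite sumr_const_nat subn0 scaler_nat.
  rewrite -sumrB.
  apply: eq_bigr => k _; rewrite natrD mulrDl stepM// SD ?(ltW b0)//.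
  rewrite semigroupB ?(ltW b0)// !opprB addrACA [RHS]addrACA; congr (_ + _).
  by rewrite addrC.
rewrite normrZ normfV normr_nat ler_pdivrMl ?ltr0n//.
have -> : N%:R * (p%:R / N%:R * ((M + 1) * e)) = (M + 1) * e *+ (p - 0).
  by rewrite subn0 -mulr_natl; field.
apply: norm_sum_nat_le => k /andP[_ kp].
have : `|S (k%:R * (b / N%:R)) z - z| <= e.
  by apply: He; rewrite k0 ler_wpM2r// ler_nat ltnW.
move: (S _ z - z) => w we.
apply: le_trans (ler_normB _ _) _; rewrite mulrDl mul1r lerD//.
apply: le_trans (SM _ _) _; first by rewrite bd ltW.
by rewrite ler_wpM2l// (le_trans _ M1).
Qed.

Let pow2_gt0 n : (0 < 2 ^ n)%N. Proof. by rewrite expn_gt0. Qed.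

Let invpow2_le n : (2 ^ n)%:R^-1 <= n.+1%:R^-1 :> R.
Proof. by rewrite lef_pV2 ?posrE ?ltr0n// ler_nat ltn_expl. Qed.

Let harmonic_lt (e : R) : 0 < e -> \forall n \near \oo, n.+1%:R^-1 < e.
Proof. by move=> e0; exact: (near_infty_natSinv_lt (PosNum e0)). Qed.

Let orbit0_le z e : 0 < e ->
  exists2 r : R, 0 < r & forall t : R, 0 <= t < r -> `|S t z - z| <= e.
Proof.
move=> e0; case: CS => _ S0 _ Sc.
have /cvgrPdist_lt/(_ e e0)/nbhs_ballP[r /= r0 Hr] := Sc z.
exists r => // t /andP[]; rewrite le_eqVlt => /predU1P[<- _|t0 tr].
  by rewrite S0 subrr normr0 ltW.
rewrite distrC ltW//; apply: Hr => //.
by rewrite /ball/= sub0r normrN gtr0_norm.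
Qed.

Let avg_cvg z : exists v : V, avg z (2 ^ n) @[n --> \oo] --> v.
Proof.
apply/cvg_ex; apply: cV; apply: cauchy_exP => e e0.
have M0 : 0 < M by rewrite (lt_le_trans ltr01).
have eM : 0 < e / (M + M) by rewrite divr_gt0// addr_gt0.
have [r r0 Hr] := orbit0_le z eM.
have [N _ HN] : \forall n \near \oo, n.+1%:R^-1 < r / b.
  by apply: harmonic_lt; rewrite divr_gt0.
exists (avg z (2 ^ N)); exists N => // n /= Nn.
rewrite -ball_normE /ball_/= distrC -(subnKC Nn) expnD.
apply: (@le_lt_trans _ _ (M * (e / (M + M)))).
  apply: avg_refine => // t /andP[t0 tb]; apply: Hr; rewrite t0/=.
  apply: le_lt_trans tb _; rewrite mulrC -ltr_pdivlMr//.
  by apply: le_lt_trans (HN N _) => /=.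
have -> : M * (e / (M + M)) = e / 2 by field; rewrite ?gt_eqF ?addr_gt0.
by rewrite ltr_pdivrMr// ltr_pMr// ltr1n.
Qed.

Let dyadic (x : R) n : R := (Num.truncn (x * (2 ^ n)%:R))%:R / (2 ^ n)%:R.

Let dyadic_itv x n : 0 <= x -> dyadic x n <= x /\ x - dyadic x n <= n.+1%:R^-1.
Proof.
move=> x0; rewrite /dyadic; have N0 : 0 < (2 ^ n)%:R :> R by rewrite ltr0n.
have /truncn_itv/andP[p1 p2] : 0 <= x * (2 ^ n)%:R by rewrite mulr_ge0.
split; first by rewrite ler_pdivrMr.
apply: le_trans (invpow2_le n).
rewrite lerBlDl -[X in _ + X]mul1r -mulrDl ler_pdivlMr// natr1 ltW//.
Qed.

Let avg_slope z v t e : avg z (2 ^ n) @[n --> \oo] --> v -> 0 < t <= b ->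
  (forall q : R, 0 <= q <= t -> `|S q z - z| <= e) ->
  `|S t v - v - (t / b) *: (S b z - z)| <= t / b * ((M + 1) * e).
Proof.
move=> av /andP[t0 tb] He.
have M0 : 0 < M by rewrite (lt_le_trans ltr01).
have e0 : 0 <= e by apply: le_trans (He 0 _); rewrite // lexx ltW.
have x0 : 0 <= t / b by rewrite divr_ge0 ?ltW.
pose q n := dyadic (t / b) n.
have q0 n : 0 <= q n by rewrite divr_ge0.
have qt n : q n * b <= t by rewrite -ler_pdivlMr// (dyadic_itv n x0).1.
have qx : q n @[n --> \oo] --> t / b.
  apply/cvgrPdist_le => eta eta0; near=> n.
  rewrite ger0_norm ?subr_ge0 ?(dyadic_itv n x0).1//.
  rewrite (le_trans (dyadic_itv n x0).2)// ltW//.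
  by near: n; exact: harmonic_lt.
have Sq : S (q n * b) (avg z (2 ^ n)) @[n --> \oo] --> S t v.
  apply/cvgrPdist_le => eta eta0.
  have etaM : 0 < eta / M / 2 by rewrite !divr_gt0.
  have [r r0 Hr] := orbit0_le v etaM.
  near=> n.
  have qd : 0 <= q n * b <= d.
    by rewrite mulr_ge0 ?(ltW b0)//= (le_trans (qt n))// (le_trans tb).
  have -> : S t v = S (q n * b) (S (t - q n * b) v).
    by rewrite -SD ?subr_ge0 ?mulr_ge0 ?(ltW b0)//; congr (S _ v); ring.
  rewrite -semigroupB//; last by case/andP: qd.
  apply: le_trans (SM _ qd) _.
  rewrite -ler_pdivlMl// (mulrC M^-1) -(subrKA v) (splitr (eta / M)).
  rewrite (le_trans (ler_normD _ _))// lerD//.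
    apply: Hr; rewrite subr_ge0 qt/=.
    have : t / b - q n < r / b.
      apply: le_lt_trans (dyadic_itv n x0).2 _.
      by near: n; apply: harmonic_lt; rewrite divr_gt0.
    by rewrite -(ltr_pM2r b0) mulrBl !divfK ?gt_eqF.
  near: n; move/cvgrPdist_le : av; apply; rewrite !divr_gt0//.
have lim : `|S (q n * b) (avg z (2 ^ n)) - avg z (2 ^ n) - q n *: (S b z - z)|
    @[n --> \oo] --> `|S t v - v - (t / b) *: (S b z - z)|.
  apply: cvg_norm; apply: cvgB; first by apply: cvgB.
  by apply: cvgZ => //; exact: cvg_cst.
apply: (cvgr_to_le lim); near=> n.
rewrite /q /dyadic; set p := Num.truncn _.
have -> : p%:R / (2 ^ n)%:R * b = p%:R * (b / (2 ^ n)%:R) by rewrite mulrAC mulrA.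
have pt : p%:R / (2 ^ n)%:R * b <= t by exact: qt.
have pN : (p <= 2 ^ n)%N.
  rewrite -(@ler_nat R) -[leRHS]mul1r -ler_pdivrMr ?ltr0n//.
  by rewrite (le_trans (dyadic_itv n x0).1)// ler_pdivrMr// mul1r.
apply: le_trans (avg_shift pN (pow2_gt0 n) _) _.
  move=> s /andP[s0 sp]; apply: He; rewrite s0 (le_trans sp)//.
  by rewrite mulrA mulrAC.
rewrite ler_wpM2r ?(dyadic_itv n x0).1//.
by rewrite mulr_ge0// addr_ge0// ltW.
Unshelve. all: by end_near. Qed.

Lemma domain_average z e : (forall t : R, 0 <= t <= b -> `|S t z - z| <= e) ->
  exists2 v, `|v - z| <= e &
    t^-1 *: (S t v - v) @[t --> 0^'+] --> b^-1 *: (S b z - z).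
Proof.
move=> He; have [v av] := avg_cvg z; exists v.
  have lim : `|avg z (2 ^ n) - z| @[n --> \oo] --> `|v - z|.
    by apply: cvg_norm; apply: cvgB => //; exact: cvg_cst.
  by apply: (cvgr_to_le lim); near=> n; exact: avg_close.
apply/cvgrPdist_le => eta eta0.
have M0 : 0 < M by rewrite (lt_le_trans ltr01).
have etaM : 0 < eta * b / (M + 1) by rewrite divr_gt0 ?mulr_gt0 ?addr_gt0.
have [r r0 Hr] := orbit0_le z etaM.
near=> t.
have t0 : 0 < t by near: t; exact: nbhs_right_gt.
have tb : t <= b by near: t; exact: nbhs_right_le.
have tr : t < r by near: t; exact: nbhs_right_lt.
have slope : `|S t v - v - (t / b) *: (S b z - z)|
    <= t / b * ((M + 1) * (eta * b / (M + 1))).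
  apply: avg_slope => //; first by rewrite t0.
  by move=> q /andP[q0 qt]; apply: Hr; rewrite q0 (le_lt_trans qt).
have -> : b^-1 *: (S b z - z) = t^-1 *: ((t / b) *: (S b z - z)).
  by rewrite scalerA mulrA mulVf ?gt_eqF// mul1r.
rewrite -scalerBr normrZ distrC gtr0_norm ?invr_gt0// ler_pdivrMl//.
apply: le_trans slope _; rewrite le_eqVlt; apply/orP; left; apply/eqP.
by field; rewrite !gt_eqF// addr_gt0.
Unshelve. all: by end_near. Qed.

End domain_dense.

Section density.
Context {R : realType} {V : normedModType R} {S : R -> V -> V}.
Context {D : set V} {A : V -> V}.

Lemma generator_dense z e : cauchy_complete V -> C0_semigroup S ->
  generates D A S -> 0 < e -> exists2 v, D v & `|v - z| <= e.
Proof.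
move=> cV CS gen e0.
have [M M1 [d d0 SM]] := C0_semigroup_bounded cV CS.
have [_ S0 _ Sc] := CS.
have /cvgrPdist_lt/(_ e e0)/nbhs_ballP[r /= r0 Hr] := Sc z.
pose b := Num.min d (r / 2).
have b0 : 0 < b by rewrite lt_min d0 divr_gt0.
have bd : b <= d by rewrite ge_min lexx.
have br : b < r.
  by apply: (@le_lt_trans _ _ (r / 2)); [rewrite ge_min lexx orbT|lra].
have [|v vz Dv] := domain_average cV CS M1 b0 bd SM (z := z) (e := e).
  move=> t /andP[]; rewrite le_eqVlt => /predU1P[<- _|t0 tb].
    by rewrite S0 subrr normr0 ltW.
  rewrite distrC ltW//; apply: Hr => //.
  by rewrite /ball/= sub0r normrN gtr0_norm// (le_lt_trans tb).
by exists v => //; have /gen[] := Dv.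
Qed.

Lemma generator_invariant z t : C0_semigroup S -> generates D A S ->
  0 <= t -> D z -> D (S t z) /\ A (S t z) = S t (A z).
Proof.
move=> CS gen t0 Dz; have [Slin _ Sadd _] := CS.
have lim : h^-1 *: (S h z - z) @[h --> 0^'+] --> A z by apply/gen.
have /gen[? <-] // : h^-1 *: (S h (S t z) - S t z) @[h --> 0^'+] --> S t (A z).
have : S t (h^-1 *: (S h z - z)) @[h --> 0^'+] --> S t (A z).
  by apply: continuous_cvg => //; exact: (Slin t t0).2.
apply: cvg_trans; apply: near_eq_cvg; near=> h.
have h0 : 0 <= h by near: h; exact: nbhs_right_ge.
by rewrite semigroupZ// semigroupB// -!Sadd// (addrC t).
Unshelve. all: by end_near. Qed.

End density.

(** * Semigroups and positivity *)

Section inner_product.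
Context {R : realType} {V : normedModType R}.
Variables (ip : V -> V -> R) (neg : V -> V).

Definition inner_product : Prop :=
  [/\ forall (a : R) x y z, ip (a *: x + y) z = a * ip x z + ip y z,
      forall x y, ip x y = ip y x &
      forall x, ip x x = `|x| ^+ 2].

(* [neg z] plays the role of the negative part of [z], i.e., of minus the
   projection of [z] on the polar of a cone. *)
Definition negative_part : Prop :=
  (forall z, ip z (neg z) = - `|neg z| ^+ 2) /\
  (forall z w, - ip z (neg w) <= ip (neg z) (neg w)).

Hypotheses (ipP : inner_product) (negP : negative_part).

Lemma ipDl x y z : ip (x + y) z = ip x z + ip y z.
Proof. by case: ipP => lip _ _; rewrite -[x]scale1r lip mul1r scale1r. Qed.

Lemma ip0l z : ip 0 z = 0.
Proof. by apply: (addrI (ip 0 z)); rewrite -ipDl !addr0. Qed.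

Lemma ipZl a x z : ip (a *: x) z = a * ip x z.
Proof. by case: ipP => lip _ _; rewrite -[a *: x]addr0 lip ip0l addr0. Qed.

Lemma ipNl x z : ip (- x) z = - ip x z.
Proof. by rewrite -scaleN1r ipZl mulN1r. Qed.

Lemma ipBl x y z : ip (x - y) z = ip x z - ip y z.
Proof. by rewrite ipDl ipNl. Qed.

Lemma ip_le x y : ip x y <= `|x| * `|y|.
Proof.
have [lip sip ip2] := ipP.
have [->|x0] := eqVneq x 0; first by rewrite ip0l normr0 mul0r.
have [->|y0] := eqVneq y 0; first by rewrite sip ip0l normr0 mulr0.
have {}x0 : 0 < `|x| by rewrite normr_gt0.
have {}y0 : 0 < `|y| by rewrite normr_gt0.
have : 0 <= ip (`|y| *: x - `|x| *: y) (`|y| *: x - `|x| *: y).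
  by rewrite ip2 sqr_ge0.
rewrite ipBl !ipZl ![ip _ (_ - _)]sip !ipBl !ipZl !ip2 (sip y x) => H.
have xy0 : 0 < `|x| * `|y| by rewrite mulr_gt0.
rewrite -(ler_pM2l xy0); nra.
Qed.

Lemma ip_norm_le x y : `|ip x y| <= `|x| * `|y|.
Proof.
rewrite ler_norml ip_le andbT lerNl -ipNl.
by rewrite (le_trans (ip_le _ _))// normrN.
Qed.

Lemma neg_ip_le z w : - ip z (neg w) <= `|neg z| * `|neg w|.
Proof. by apply: le_trans (ip_le _ _); case: negP. Qed.

Lemma neg_normD x y : `|neg (x + y)| <= `|neg x| + `|neg y|.
Proof.
have [n1 _] := negP.
have [->|n0] := eqVneq `|neg (x + y)| 0; first by rewrite addr_ge0.
have {}n0 : 0 < `|neg (x + y)| by rewrite lt_def n0/=.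
rewrite -(ler_pM2r n0) -expr2 -[leLHS]opprK -n1 ipDl opprD mulrDl.
by rewrite lerD// neg_ip_le.
Qed.

Lemma neg_norm_le x : `|neg x| <= `|x|.
Proof.
have [n1 _] := negP.
have [->//|n0] := eqVneq `|neg x| 0.
have {}n0 : 0 < `|neg x| by rewrite lt_def n0/=.
rewrite -(ler_pM2r n0) -expr2 -[leLHS]opprK -n1 -ipNl.
by rewrite (le_trans (ip_le _ _))// normrN.
Qed.

Lemma neg_norm_lip x y : `|neg x| <= `|neg y| + `|x - y|.
Proof.
rewrite -[x in leLHS](subrKC y) (le_trans (neg_normD _ _))// lerD2l.
exact: neg_norm_le.
Qed.

Lemma neg_norm_cvg {T : Type} (F : set_system T) {FF : Filter F} (u : T -> V) v :
  u x @[x --> F] --> v -> `|neg (u x)| @[x --> F] --> `|neg v|.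
Proof.
move=> uv; apply/cvgrPdist_le => e e0; near=> x.
have uxv : `|v - u x| <= e by near: x; move/cvgrPdist_le : uv; apply.
rewrite ler_distl lerBlDr; apply/andP; split.
  by rewrite (le_trans (neg_norm_lip _ v))// lerD2l distrC.
by rewrite (le_trans (neg_norm_lip _ (u x)))// lerD2l.
Unshelve. all: by end_near. Qed.

(* On the domain, [S h z - z - h *: S h (A z)] is [o(h)] by continuity of the
   orbit of [A z]: pairing [S h z] with its negative part then bounds the right
   derivative of [|neg (S t z)|] at [t = 0]. *)
Lemma dispersive_semigroup (S : R -> V -> V) (D : set V) (A : V -> V) (w : R) :
  cauchy_complete V -> C0_semigroup S -> generates D A S -> 0 <= w ->
  (forall z, D z -> - ip (A z) (neg z) <= w * `|neg z| ^+ 2) ->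
  forall (t : R) z, 0 <= t -> `|neg (S t z)| <= expR (2 * w * t) * `|neg z|.
Proof.
move=> cV CS gen w0 disp t z t0.
have [n1 _] := negP; have n2 := neg_ip_le; have [Slin S0 Sadd Sc] := CS.
wlog Dz : z / D z => [main|].
  apply/ler_addgt0Pr => e e0.
  have [M M0 SM] := continuous_linear_le (Slin t t0).1 (Slin t t0).2.
  pose E := expR (2 * w * t).
  have E0 : 0 < E by exact: expR_gt0.
  have eEM : 0 < e / (E + M) by rewrite divr_gt0// ltr_wpDr.
  have [v Dv vz] := generator_dense z cV CS gen eEM.
  apply: le_trans (neg_norm_lip _ (S t v)) _; rewrite -semigroupB//.
  apply: (@le_trans _ _ (E * (`|neg z| + `|v - z|) + M * `|v - z|)).
    rewrite lerD// ?(distrC v)//; apply: le_trans (main _ Dv) _.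
    by rewrite distrC ler_wpM2l ?(ltW E0)// neg_norm_lip.
  rewrite mulrDr -addrA lerD2l -mulrDl mulrC -ler_pdivlMr//.
  by rewrite ltr_wpDr.
have := @dini_gronwall R (fun t => `|neg (S t z)|) (2 * w).
rewrite S0; apply => // [|s s0|s s0 e e0].
- by rewrite mulr_ge0.
- by apply: neg_norm_cvg; exact: C0_semigroup_left.
have [Dsz ASz] := generator_invariant CS gen s0 Dz.
set zs := S s z in Dsz *; set a := S s (A z) in ASz.
have e4 : 0 < e / 4 by rewrite divr_gt0.
have /cvgrPdist_le/(_ _ e4) slope :
  h^-1 *: (S h zs - zs) @[h --> 0^'+] --> a by rewrite -ASz; apply/gen.
have /cvgrPdist_le/(_ _ e4) conta := Sc a.
near=> h.
have h0 : 0 < h by near: h; exact: nbhs_right_gt.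
have hw : h * w <= 2^-1.
  have : h <= (2 * (w + 1))^-1.
    near: h; apply: nbhs_right_le.
    by rewrite invr_gt0 mulr_gt0// ltr_wpDl.
  rewrite -[leRHS]mul1r ler_pdivlMr; last by rewrite mulr_gt0// ltr_wpDl.
  by nra.
have sl : `|a - h^-1 *: (S h zs - zs)| <= e / 4 by near: h.
have ca : `|a - S h a| <= e / 4 by near: h.
have shE : S (s + h) z = S h zs by rewrite addrC Sadd// ltW.
rewrite shE; have [Dw Aw] := generator_invariant CS gen (ltW h0) Dsz.
rewrite ASz in Aw; set x := S h zs in sl Dw Aw *.
have diff : `|x - zs - h *: S h a| <= h * (e / 2).
  have -> : x - zs - h *: S h a =
      h *: ((a - S h a) - (a - h^-1 *: (x - zs))).
    rewrite opprB [in RHS]addrC subrKA scalerBr scalerA mulfV ?gt_eqF// scale1r.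
    by [].
  rewrite normrZ gtr0_norm// ler_wpM2l ?(ltW h0)//.
  apply: le_trans (ler_normB _ _) _; lra.
have [->|nx0] := eqVneq `|neg x| 0.
  by rewrite addr_ge0// mulr_ge0 ?ltW// ltr_wpDl// !mulr_ge0.
have {}nx0 : 0 < `|neg x| by rewrite lt_def nx0/=.
have key : `|neg x| ^+ 2 <= `|neg zs| * `|neg x| + h * (w * `|neg x| ^+ 2)
    + h * (e / 2) * `|neg x|.
  rewrite -[leLHS]opprK -n1.
  have -> : ip x (neg x) = ip zs (neg x) + h * ip (A x) (neg x)
      + ip (x - zs - h *: S h a) (neg x).
    by rewrite Aw !ipBl ipZl; ring.
  rewrite !opprD; apply: lerD; first apply: lerD => //.
    by rewrite -mulrN ler_wpM2l ?(ltW h0)// disp.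
  rewrite -ipNl (le_trans (ip_le _ _))// normrN ler_wpM2r//.
have {}key : `|neg x| <= `|neg zs| + h * (w * `|neg x|) + h * (e / 2).
  by rewrite -(ler_pM2r nx0); nra.
have n0 : 0 <= `|neg zs| by [].
have dbl : `|neg x| <= 2 * (`|neg zs| + h * (e / 2)) by nra.
have hw0 : 0 <= h * w by rewrite mulr_ge0 ?(ltW h0).
have := ler_wpM2l hw0 dbl.
have he0 : 0 <= h * e by rewrite mulr_ge0 ?ltW.
have := ler_wpM2r he0 hw.
nra.
Unshelve. all: by end_near. Qed.

End inner_product.

(** * Bochner integrals and mild solutions *)

Lemma limn_einf_le {R : realType} (u : (\bar R)^nat) (c : \bar R) :
  (\forall n \near \oo, u n <= c)%E -> (limn_einf u <= c)%E.
Proof.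
move=> uc; rewrite limn_einf_lim; apply: lime_le; first exact: is_cvg_einfs.
near=> n; apply: (@le_trans _ _ (u n)); last by near: n.
by apply: ereal_inf_lbound; exists n => /=.
Unshelve. all: by end_near. Qed.

Section L1_limit.
Context d (T : measurableType d) (R : realType).
Variables (mu : {measure set T -> \bar R}) (D : set T).
Hypothesis mD : measurable D.

Lemma L1_cauchy_limit (q : nat -> T -> R) (f : T -> R) :
  (forall n, mu.-integrable D (EFin \o q n)) ->
  {ae mu, forall x, D x -> q n x @[n --> \oo] --> f x} ->
  (forall e : R, 0 < e -> exists N, forall n n', (N <= n)%N -> (N <= n')%N ->
    (\int[mu]_(x in D) (`|q n x - q n' x|)%:E < e%:E)%E) ->
  exists g : T -> R, [/\ mu.-integrable D (EFin \o g),
    {ae mu, forall x, D x -> g x = f x} &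
    \int[mu]_(x in D) q n x @[n --> \oo] --> \int[mu]_(x in D) g x].
Proof.
move=> iq qf cq.
have mq n : measurable_fun D (fun x => (q n x)%:E) by have /integrableP[] := iq n.
have mqR n : measurable_fun D (q n) by apply/measurable_EFinP; exact: mq.
pose g x := fine (limn_esup (fun n => (q n x)%:E)).
have mg : measurable_fun D g.
  apply: measurableT_comp; first exact: measurable_realfun.fine_measurable.
  exact: measurable_fun_limn_esup.
have gf : {ae mu, forall x, D x -> g x = f x}.
  apply: filterS qf => x qf Dx.
  have lim : (q n x)%:E @[n --> \oo] --> (f x)%:E.
    by apply: cvg_EFin; [exact: nearW|exact: qf].
  by rewrite /g (cvg_limn_einf_sup lim).2.
have close e : 0 < e -> exists N, forall n, (N <= n)%N ->
    (\int[mu]_(x in D) (`|g x - q n x|)%:E <= e%:E)%E.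
  move=> e0; have [N HN] := cq e e0; exists N => n Nn.
  pose u m x := (`|q m x - q n x|)%:E.
  have mu_ m : measurable_fun D (u m).
    by apply/measurable_EFinP; apply: measurableT_comp => //; exact: measurable_funB.
  apply: (@le_trans _ _ (\int[mu]_(x in D) limn_einf (u^~ x))%E); last first.
    apply: le_trans (fatou mu mD mu_ _) _; first by move=> m x _; rewrite lee_fin.
    apply: limn_einf_le; exists N => // m /= Nm.
    exact/ltW/HN.
  apply: ae_ge0_le_integral => //.
  - by apply/measurable_EFinP; apply: measurableT_comp => //; exact: measurable_funB.
  - move=> x Dx; rewrite limn_einf_lim; apply: lime_ge; first exact: is_cvg_einfs.
    by near=> m; apply: le_ereal_inf_tmp => _ [k _ <-]; rewrite lee_fin.
  - rewrite (_ : (fun _ => _) = -%E \o (fun x => limn_esup ((-%E \o (u^~ x))))).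
      apply: measurableT_comp => //; apply: measurable_fun_limn_esup => m.
      exact: measurableT_comp.
    by apply/funext => x /=; rewrite limn_esupN oppeK.
  apply: filterS2 qf gf => x qf gf Dx; rewrite gf//.
  have lim : (u m x @[m --> \oo] --> (`|f x - q n x|)%:E).
    apply: cvg_EFin; first exact: nearW.
    apply: cvg_norm; apply: cvgB; [exact: qf|exact: cvg_cst].
  by have [-> _] := cvg_limn_einf_sup lim.
have igq n :
    (\int[mu]_(x in D) (`|g x - q n x|)%:E < +oo)%E ->
    mu.-integrable D (EFin \o (fun x => g x - q n x)).
  move=> fin; apply/integrableP; split => //.
  by apply/measurable_EFinP; exact: measurable_funB.
have ig : mu.-integrable D (EFin \o g).
  have [N HN] := close 1 ltr01.
  have := @integrableD _ _ _ mu D mD _ _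
    (igq N (le_lt_trans (HN N (leqnn N)) (ltry 1))) (iq N).
  apply: eq_integrable => // x _ /=.
  by rewrite -EFinD subrK.
exists g; split => //.
apply/cvgrPdist_le => e e0; have [N HN] := close e e0.
exists N => // n /= Nn.
rewrite -RintegralB//; apply: le_trans (le_normr_Rintegral _ _) _ => //.
  exact: (igq n (le_lt_trans (HN n Nn) (ltry e))).
rewrite -lee_fin fineK//; first exact: HN.
rewrite ge0_fin_numE; first exact: le_lt_trans (HN n Nn) (ltry e).
by apply: integral_ge0 => x _; rewrite lee_fin.
Unshelve. all: by end_near. Qed.

End L1_limit.

Section simple_functions.
Context d (T : measurableType d) (R : realType) (V : normedModType R).
Variables (mu : {measure set T -> \bar R}) (D : set T).

Lemma measurable_simple_comp k (A : 'I_k -> set T) (a : 'I_k -> V)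
    (Phi : V -> T -> R) :
  (forall i, measurable (A i)) -> (forall v, measurable_fun setT (Phi v)) ->
  measurable_fun setT (fun x => Phi (\sum_i (\1_(A i) x : R) *: a i) x).
Proof.
elim: k A a Phi => [|k IH] A a Phi mA mPhi.
  rewrite (_ : (fun _ => _) = Phi 0)//.
  by apply/funext => x; rewrite big_ord0.
rewrite (_ : (fun _ => _) = (fun x => Phi (\1_(A ord0) x *: a ord0 +
    \sum_(i < k) \1_(A (lift ord0 i)) x *: a (lift ord0 i)) x)); last first.
  by apply/funext => x; rewrite big_ord_recl.
pose Psi v x := if x \in A ord0 then Phi (a ord0 + v) x else Phi v x.
have -> : (fun x => Phi (\1_(A ord0) x *: a ord0 +
      \sum_(i < k) \1_(A (lift ord0 i)) x *: a (lift ord0 i)) x) =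
    (fun x => Psi (\sum_(i < k) \1_(A (lift ord0 i)) x *: a (lift ord0 i)) x).
  apply/funext => x; rewrite /Psi indicE; case: ifPn => _.
    by rewrite scale1r.
  by rewrite scale0r add0r.
apply: IH => // v; apply: measurable_fun_ifT => //.
apply: (@measurable_fun_bool _ _ _ _ true); rewrite setTI preimage_mem_true.
exact: mA.
Qed.

Lemma Rintegral_sum (I : Type) (s : seq I) (F : I -> T -> R) : measurable D ->
  (forall i, mu.-integrable D (EFin \o F i)) ->
  mu.-integrable D (EFin \o (fun x => \sum_(i <- s) F i x)) /\
  \int[mu]_(x in D) (\sum_(i <- s) F i x) =
    \sum_(i <- s) \int[mu]_(x in D) F i x.
Proof.
move=> mD iF; elim: s => [|i s [IH1 IH2]].
  split; last first.
    by under eq_Rintegral do rewrite big_nil; rewrite big_nil Rintegral_cst// mul0r.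
  by apply: eq_integrable (integrable0 mu D) => // x _ /=; rewrite big_nil.
have E : (fun x => \sum_(j <- i :: s) F j x) =
    (fun x => F i x + \sum_(j <- s) F j x).
  by apply/funext => x; rewrite big_cons.
rewrite big_cons -IH2 -RintegralD// E; split => //.
by apply: eq_integrable (integrableD mD (iF i) IH1).
Qed.

(* [l \o f] need not be measurable: it is the almost everywhere limit of
   measurable functions, whence the representative [g]. *)
Lemma bochner_scalar (l : V -> R) (K : R) (f : T -> V) (v : V) : measurable D ->
  (forall a x y, l (a *: x + y) = a * l x + l y) ->
  (forall x, `|l x| <= K * `|x|) ->
  is_bochner_integral mu D f v ->
  exists g : T -> R, [/\ mu.-integrable D (EFin \o g),
    {ae mu, forall x, D x -> g x = l (f x)} & l v = \int[mu]_(x in D) g x].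
Proof.
move=> mD ll lK [s [sf cs sv]].
have l0 : l 0 = 0 by have := ll (-1) 0 0; rewrite scaleN1r oppr0 addr0 mulN1r addNr.
have lB x y : l (x - y) = l x - l y.
  by rewrite addrC -scaleN1r ll mulN1r addrC.
have lsum k (c : 'I_k -> R) (a : 'I_k -> V) :
    l (\sum_i c i *: a i) = \sum_i c i * l (a i).
  elim: k c a => [|k IH] c a; first by rewrite !big_ord0.
  by rewrite !big_ord_recl ll IH.
have lcont (X : Type) (F : set_system X) (FF : Filter F) (u : X -> V) w :
    u x @[x --> F] --> w -> l (u x) @[x --> F] --> l w.
  move=> uw; apply/cvgrPdist_le => e e0.
  have K0 : 0 < `|K| + 1 by rewrite ltr_wpDl.
  have eK : 0 < e / (`|K| + 1) by rewrite divr_gt0.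
  near=> x.
  have : `|w - u x| <= e / (`|K| + 1) by near: x; move/cvgrPdist_le : uw; apply.
  rewrite -lB (ler_pdivlMr _ _ K0) => H; apply: le_trans (lK _) _.
  apply: le_trans H; rewrite mulrC ler_wpM2l//.
  by rewrite (le_trans (ler_norm K))// lerDl.
pose q n x := l (sf_eval (s n) x).
pose F n i x : R := \1_(sf_set (s := s n) i) x * l (sf_val (s := s n) i).
have qE n : q n = (fun x => \sum_i F n i x) by apply/funext => x; exact: lsum.
have mF n i : measurable_fun setT (fun x => \1_(sf_set (s := s n) i) x : R).
  by apply: measurable_indic; exact: sf_measurable.
have i1 n i : mu.-integrable D (EFin \o \1_(sf_set (s := s n) i)).
  apply/integrableP; split.
    by apply/measurable_EFinP; exact: measurable_funTS.
  under eq_integral do rewrite /= ger0_norm//.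
  by rewrite integral_indic//; [exact: sf_finite|exact: sf_measurable].
have iF n i : mu.-integrable D (EFin \o F n i).
  apply: eq_integrable (integrableZr mD (l (sf_val (s := s n) i)) (i1 n i)) => //.
have [] := @L1_cauchy_limit _ _ _ mu D mD q (fun x => l (f x)).
- by move=> n; rewrite qE; have [] := Rintegral_sum (index_enum _) mD (iF n).
- by apply: filterS sf => x sf Dx; apply: lcont; exact: sf.
- move=> e e0; have K0 : 0 < `|K| + 1 by rewrite ltr_wpDl.
  have eK : 0 < e / (`|K| + 1) by rewrite divr_gt0.
  have [N HN] := cs _ eK; exists N => n n' Nn Nn'.
  have mn : measurable_fun setT
      (fun x => `|sf_eval (s n) x - sf_eval (s n') x|).
    pose Phi w x := `|w - sf_eval (s n') x|.
    apply: (@measurable_simple_comp _ (sf_set (s := s n)) (sf_val (s := s n))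
      Phi) => [i|w].
      exact: sf_measurable.
    pose Psi w' (_ : T) := `|w - w'|.
    apply: (@measurable_simple_comp _ (sf_set (s := s n')) (sf_val (s := s n'))
      Psi) => [i|w']; [exact: sf_measurable|exact: measurable_cst].
  have mq k : measurable_fun setT (q k).
    pose Phi w (_ : T) := l w.
    apply: (@measurable_simple_comp _ (sf_set (s := s k)) (sf_val (s := s k))
      Phi) => [i|w']; [exact: sf_measurable|exact: measurable_cst].
  apply: (@le_lt_trans _ _ (\int[mu]_(x in D)
      ((`|K| + 1)%:E * (`|sf_eval (s n) x - sf_eval (s n') x|)%:E))%E).
    apply: ge0_le_integral => //.
    + apply/measurable_EFinP/measurable_funTS; apply: measurableT_comp => //.
      exact: measurable_funB.
    + apply: emeasurable_funM => //.
      by apply/measurable_EFinP; exact: measurable_funTS.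
    + move=> x Dx; rewrite -EFinM lee_fin -lB (le_trans (lK _))// ler_wpM2r//.
      by rewrite (le_trans (ler_norm K))// lerDl.
  rewrite ge0_integralZl//; last first.
    by apply/measurable_EFinP; exact: measurable_funTS.
  rewrite muleC -lte_pdivlMr//.
  exact: HN.
move=> g [ig gf lim]; exists g; split => //.
have lim2 : l (sf_integral (s n)) @[n --> \oo] --> l v by exact: lcont.
apply: (cvg_unique _ lim2) => //.
apply: cvg_trans lim; apply: near_eq_cvg; near=> n.
rewrite lsum qE (Rintegral_sum (index_enum _) mD (iF n)).2; apply: eq_bigr => i _.
rewrite /F RintegralZr//; congr (_ * _).
by rewrite /Rintegral integral_indic//; exact: sf_measurable.
Unshelve. all: by end_near. Qed.

End simple_functions.

Section mild_solutions.
Context {R : realType} {V : normedModType R} {ip : V -> V -> R} {neg : V -> V}.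
Hypotheses (ipP : inner_product ip) (negP : negative_part ip neg).
Context {S : R -> V -> V} {F : R -> V -> V} {y0 : V} {y : R -> V}.
Hypotheses (cV : cauchy_complete V) (CS : C0_semigroup S).
Hypothesis ymild : mild_solution S F y0 y.

Let SD t t' x : 0 <= t -> 0 <= t' -> S (t + t') x = S t (S t' x).
Proof. by case: CS => _ _ + _; apply. Qed.

Let ipl_lin (g : V) (a : R) x z : - ip (a *: x + z) g = a * (- ip x g) + - ip z g.
Proof. by rewrite (ipDl ipP) (ipZl ipP); ring. Qed.

Let ipl_le (g x : V) : `|- ip x g| <= `|g| * `|x|.
Proof. by rewrite normrN mulrC; exact: ip_norm_le. Qed.

Lemma mild_solution0 : y 0 = y0.
Proof.
have [_ /(_ 0 (lexx 0))[v vint ->]] := ymild.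
have [_ S0 _ _] := CS; rewrite S0.
have [g [ig _]] := bochner_scalar (mu := @lebesgue_measure R)
  (measurable_itv _) (ipl_lin v) (ipl_le v) vint.
rewrite set_itv1 Rintegral_set1 => /eqP; rewrite oppr_eq0.
case: ipP => _ _ ->; rewrite sqrf_eq0 normr_eq0 => /eqP ->.
by rewrite addr0.
Qed.

Lemma mild_step_le (t h c : R) (g : V) : 0 <= t -> 0 < h ->
  (forall s, t < s <= t + h -> - ip (S (t + h - s) (F s (y s))) g <= c) ->
  - ip (y (t + h) - S h (y t)) g <= h * c.
Proof.
move=> t0 h0 Hc; have [_ ym] := ymild.
have mI (i : interval R) : measurable ([set` i] : set (measurableTypeR R)).
  exact: measurable_itv.
have th0 : 0 <= t + h by rewrite addr_ge0 // ltW.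
have [v1 v1int yt] := ym _ t0; have [v2 v2int yth] := ym _ th0.
have -> : y (t + h) - S h (y t) = v2 - S h v1.
  rewrite yth yt semigroupD ?(ltW h0)// -SD ?(ltW h0)// (addrC h).
  by rewrite opprD addrACA subrr add0r.
have [Slin _ _ _] := CS; have [lS cS] := Slin h (ltW h0).
have [M M0 SM] := continuous_linear_le lS cS.
have [g2 [ig2 g2E v2E]] :=
  bochner_scalar (mu := @lebesgue_measure R) (measurable_itv _)
    (ipl_lin g) (ipl_le g) v2int.
have l1_lin a x z : - ip (S h (a *: x + z)) g =
    a * (- ip (S h x) g) + - ip (S h z) g by rewrite lS ipl_lin.
have l1_le x : `|- ip (S h x) g| <= (`|g| * M) * `|x|.
  by rewrite (le_trans (ipl_le _ _))// -mulrA ler_wpM2l.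
have [g1 [ig1 g1E v1E]] :=
  bochner_scalar (mu := @lebesgue_measure R) (measurable_itv _) l1_lin l1_le v1int.
have sub : `[0, t] `<=` `[0, t + h].
  by apply: subset_itvl; rewrite bnd_simp lerDl ltW.
have g12 : \int[lebesgue_measure]_(x in `[0, t]) g1 x =
    \int[lebesgue_measure]_(x in `[0, t]) g2 x.
  congr fine; apply: ae_eq_integral => //.
  - by case/integrableP : ig1.
  - by case/integrableP : (integrableS (mI _) (mI _) sub ig2).
  apply: filterS2 g1E g2E => s g1E g2E Ds.
  rewrite g1E// g2E; last exact: sub.
  move: Ds; rewrite /= in_itv/= => /andP[s0 st].
  by rewrite -SD ?(ltW h0) ?subr_ge0// addrA (addrC h).
rewrite (ipBl ipP).
have -> : - (ip v2 g - ip (S h v1) g) = - ip v2 g - - ip (S h v1) g by ring.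
rewrite v2E v1E g12 Rintegral_itvB//; last by rewrite bnd_simp lerDl ltW.
pose D := `]t, t + h]%classic : set R.
have subD : D `<=` `[0, t + h] by apply: subset_itvr; rewrite bnd_simp.
have mD : measurable (D : set (measurableTypeR R)) by exact: mI.
have muD : lebesgue_measure D = h%:E.
  by rewrite lebesgue_measure_itv/= lte_fin ltrDl h0 -EFinB addrC addKr.
have igD : lebesgue_measure.-integrable D (EFin \o g2).
  exact: integrableS ig2.
have icD : lebesgue_measure.-integrable D (EFin \o cst c).
  apply/integrableP; split; first exact/measurable_EFinP.
  by rewrite /= integral_cst//= muD -EFinM ltry.
have id : lebesgue_measure.-integrable D (EFin \o (fun x => c - g2 x)).
  by apply: eq_integrable (integrableB mD icD igD).
have : 0 <= \int[lebesgue_measure]_(x in D) (c - g2 x).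
  have -> : \int[lebesgue_measure]_(x in D) (c - g2 x) =
      \int[lebesgue_measure]_(x in D) `|c - g2 x|.
    have /integrableP[mcg _] := id.
    congr fine; apply: ae_eq_integral => //.
      apply/measurable_EFinP; apply: measurableT_comp => //.
      exact/measurable_EFinP.
    apply: filterS g2E => x g2E Dx.
    rewrite ger0_norm// subr_ge0 g2E; last exact: subD.
    by apply: Hc; move: Dx; rewrite /D/= in_itv.
  by apply: Rintegral_ge0 => x _.
rewrite RintegralB// Rintegral_cst// subr_ge0 => /le_trans; apply.
by rewrite [fine _](congr1 fine muD) mulrC.
Qed.

Let y_within (t e : R) : 0 <= t -> 0 < e -> exists2 d : R, 0 < d &
  forall s, 0 <= s -> `|s - t| < d -> `|y s - y t| <= e.
Proof.
move=> t0 e0; have [/subspace_continuousP yc _] := ymild.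
have := yc t; rewrite /= in_itv/= andbT => /(_ t0).
move=> /cvgrPdist_le/(_ e e0); rewrite near_withinE.
move=> /nbhs_ballP[d /= d0 Hd]; exists d => // s s0 st.
rewrite distrC; apply: Hd; last by rewrite /= in_itv/= s0.
by rewrite /ball/= distrC.
Qed.

Lemma quasi_positive_invariant (w K lam : R) : 0 <= w -> 0 <= K -> 0 <= lam ->
  (forall (t : R) z, 0 <= t -> `|neg (S t z)| <= expR (w * t) * `|neg z|) ->
  (forall (t : R) z, 0 <= t -> `|neg (F t z + lam *: z)| <= K * `|neg z|) ->
  `|neg y0| = 0 -> forall t : R, 0 <= t -> `|neg (y t)| = 0.
Proof.
move=> w0 K0 lam0 Sneg Fneg ny0 t0 t0ge.
pose E := expR w; pose C := w * E + E * K.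
have E0 : 0 < E by exact: expR_gt0.
apply/eqP; rewrite eq_le normr_ge0 andbT.
suff : `|neg (y t0)| <= expR (C * t0) * `|neg (y 0)|.
  by rewrite mild_solution0 ny0 mulr0.
apply: (@dini_gronwall R (fun t => `|neg (y t)|) C) => // {t0 t0ge}.
- by rewrite addr_ge0// mulr_ge0// ltW.
- move=> t t0; apply: (neg_norm_cvg ipP negP).
  apply/cvgrPdist_le => e e0; have [d d0 Hd] := y_within (ltW t0) e0.
  near=> s; rewrite distrC; apply: Hd.
    by near: s; exact: nbhs_left_ge.
  rewrite distrC ger0_norm; last first.
    by rewrite subr_ge0; near: s; exact: nbhs_left_le.
  rewrite ltrBlDr -ltrBlDl; near: s.
  by apply: nbhs_left_gt; rewrite ltrBlDr ltrDl.
move=> t t0 e e0.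
have [M M1 [d d0 SM]] := C0_semigroup_bounded cV CS.
have [n1 _] := negP; have n2 := neg_ip_le ipP negP; have [_ S0 _ Sc] := CS.
pose eta := e / (E * K + lam + 1).
have EKl : 0 <= E * K + lam by rewrite addr_ge0// mulr_ge0// ltW.
have eta0 : 0 < eta by rewrite divr_gt0// ltr_wpDl.
have M20 : 0 < M + 2 by rewrite addr_gt0// (lt_le_trans ltr01).
have dl0 : 0 < eta / (M + 2) by rewrite divr_gt0.
have [r1 r10 Hr1] := y_within t0 dl0.
have [r2 r20 Hr2] : exists2 r : R, 0 < r &
    forall s, 0 <= s < r -> `|S s (y t) - y t| <= eta / (M + 2).
  have /cvgrPdist_lt/(_ _ dl0)/nbhs_ballP[r /= r0 Hr] := Sc (y t).
  exists r => // s /andP[]; rewrite le_eqVlt => /predU1P[<- _|s0 sr].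
    by rewrite S0 subrr normr0 ltW.
  by rewrite distrC ltW//; apply: Hr => //; rewrite /ball/= sub0r normrN gtr0_norm.
near=> h.
have h0 : 0 < h by near: h; exact: nbhs_right_gt.
have h1 : h <= 1 by near: h; exact: nbhs_right_le.
have hd : h <= d by near: h; exact: nbhs_right_le.
have hr1 : h < r1 by near: h; exact: nbhs_right_lt.
have hr2 : h < r2 by near: h; exact: nbhs_right_lt.
have hl : h * lam <= 1.
  have : h <= (lam + 1)^-1.
    by near: h; apply: nbhs_right_le; rewrite invr_gt0 ltr_wpDl.
  rewrite -[leRHS]mul1r ler_pdivlMr; last by rewrite ltr_wpDl.
  nra.
set x := y (t + h); set nt := `|neg (y t)|.
have nt0 : 0 <= nt by exact: normr_ge0.
have etale : eta / (M + 2) <= eta.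
  by rewrite ler_pdivrMr//; nra.
have yclose s : t < s <= t + h -> `|y s - y t| <= eta / (M + 2).
  move=> /andP[ts sh]; apply: Hr1; first by rewrite (le_trans t0)// ltW.
  by rewrite gtr0_norm ?subr_gt0// (le_lt_trans _ hr1)// lerBlDl.
have Sclose s : t < s <= t + h -> `|S (t + h - s) (y s) - S h (y t)| <= eta.
  move=> /[dup] ts /andP[ts1 ts2].
  have u0 : 0 <= t + h - s by rewrite subr_ge0.
  have uh : t + h - s <= h by lra.
  have -> : S (t + h - s) (y s) - S h (y t) =
      S (t + h - s) (y s - y t) +
      ((S (t + h - s) (y t) - y t) - (S h (y t) - y t)).
    by rewrite semigroupB// opprB !subrKA.
  have -> : eta = M * (eta / (M + 2)) + (eta / (M + 2) + eta / (M + 2)).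
    by field; rewrite gt_eqF.
  apply: le_trans (ler_normD _ _) _; rewrite lerD//.
    apply: le_trans (SM _ _ _) _; first by rewrite u0 (le_trans uh).
    by rewrite ler_wpM2l ?yclose// (le_trans ler01).
  apply: le_trans (ler_normB _ _) _; rewrite lerD// Hr2//.
    by rewrite u0 (le_lt_trans uh).
  by rewrite (ltW h0).
set n := `|neg x|; set a := - ip (S h (y t)) (neg x).
have [->|nx0] := eqVneq n 0.
  rewrite addr_ge0// mulr_ge0 ?(ltW h0)// addr_ge0 ?(ltW e0)// mulr_ge0//.
  by rewrite addr_ge0// mulr_ge0// ltW.
have {}nx0 : 0 < n by rewrite lt_def nx0; exact: normr_ge0.
have step : - ip (x - S h (y t)) (neg x) <=
    h * (E * K * (nt + eta) * n - lam * a + lam * eta * n).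
  apply: mild_step_le => // s ts; have /andP[ts1 ts2] := ts.
  have s0 : 0 <= s by rewrite (le_trans t0)// ltW.
  have u0 : 0 <= t + h - s by rewrite subr_ge0.
  have u1 : t + h - s <= 1 by lra.
  set u := t + h - s in u0 u1 *.
  have -> : F s (y s) = (F s (y s) + lam *: y s) - lam *: y s by rewrite addrK.
  rewrite semigroupB// semigroupZ// (ipBl ipP) (ipZl ipP) opprB addrC -addrA.
  apply: lerD.
    apply: le_trans (n2 _ _) _; rewrite ler_wpM2r//.
    apply: le_trans (Sneg _ _ u0) _; rewrite -mulrA ler_pM ?expR_ge0//.
      by rewrite ler_expR ler_piMr.
    apply: le_trans (Fneg _ _ s0) _; rewrite ler_wpM2l//.
    apply: le_trans (neg_norm_lip ipP negP _ (y t)) _; rewrite lerD2l.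
    exact: le_trans (yclose _ ts) etale.
  rewrite -mulrA -mulrN -mulrDr ler_wpM2l//.
  have -> : ip (S u (y s)) (neg x) =
      - a + ip (S u (y s) - S h (y t)) (neg x).
    by rewrite (ipBl ipP) /a; ring.
  rewrite lerD2l; apply: le_trans (ip_le ipP _ _) _.
  by rewrite ler_wpM2r// Sclose.
have a_le : a <= expR (w * h) * nt * n.
  apply: le_trans (n2 _ _) _; rewrite ler_wpM2r//.
  exact: Sneg (ltW h0).
have key : n ^+ 2 <= (1 - h * lam) * a
    + h * (E * K * (nt + eta) + lam * eta) * n.
  rewrite -[leLHS]opprK -n1 -[x in ip x _](subrK (S h (y t))) (ipDl ipP) opprD.
  move: step; rewrite -/a; lra.
have ex : expR (w * h) <= 1 + h * (w * E).
  have wh0 : 0 <= w * h by rewrite mulr_ge0// ltW.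
  have ewh : expR (w * h) <= E by rewrite ler_expR ler_piMr.
  have := expR_ge1Dx (- (w * h)); rewrite expRN.
  have eg : 0 < expR (w * h) by exact: expR_gt0.
  rewrite -(ler_pM2r eg) mulVf ?gt_eqF// => Hx.
  have : w * h * expR (w * h) <= w * h * E by rewrite ler_wpM2l.
  lra.
have b_le : (1 - h * lam) * a <= expR (w * h) * nt * n.
  apply: (@le_trans _ _ ((1 - h * lam) * (expR (w * h) * nt * n))).
    by rewrite ler_wpM2l// subr_ge0.
  apply: ler_piMl; last by rewrite gerBl mulr_ge0// ltW.
  by rewrite mulr_ge0 ?(ltW nx0)// mulr_ge0// expR_ge0.
have {b_le} key2 : n <= expR (w * h) * nt + h * (E * K * (nt + eta) + lam * eta).
  rewrite -(ler_pM2r nx0) -expr2 (le_trans key)// [leRHS]mulrDl lerD2r.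
  by rewrite (le_trans b_le).
apply: le_trans key2 _.
have le1 : expR (w * h) * nt <= (1 + h * (w * E)) * nt by rewrite ler_wpM2r.
have etae : (E * K + lam) * eta <= e.
  rewrite /eta mulrCA ler_piMr ?(ltW e0)// ler_pdivrMr ?mul1r ?ltr_wpDl//.
  by rewrite lerDl.
have := ler_wpM2l (ltW h0) etae; rewrite /C; nra.
Unshelve. all: by end_near. Qed.

End mild_solutions.

(** * The Hilbert lattice of square integrable functions *)

Section fast_sequences.
Context {R : realType}.

(* With this rate, [4^n] times the square of the n-th increment is summable. *)
Definition fast_complete (V : normedModType R) : Prop :=
  forall u : nat -> V, (forall n, `|u n.+1 - u n| <= 4^-1 ^+ n) ->
  cvg (u @ \oo).

Lemma fast_complete_cauchy (V : normedModType R) :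
  fast_complete V -> cauchy_complete V.
Proof.
move=> fV F FF cF.
pose r n : R := 4^-1 ^+ n / 2.
have r0 n : 0 < r n by rewrite divr_gt0// exprn_gt0// invr_gt0.
have /choice[u Hu] (n : nat) : exists x : V, F (ball x (r n)).
  exact: (@cauchyP R V F FF).1 cF (r n) (r0 n).
have incr n : `|u n.+1 - u n| <= 4^-1 ^+ n.
  have /filter_ex[x [xn xn1]] : F (ball (u n) (r n) `&` ball (u n.+1) (r n.+1)).
    by apply: filterI; exact: Hu.
  rewrite -ball_normE /ball_/= in xn; rewrite -ball_normE /ball_/= in xn1.
  rewrite -(subrKA x) (le_trans (ler_normD _ _))//.
  have : `|x - u n| < r n by rewrite distrC.
  have : r n.+1 <= r n.
    rewrite /r ler_pM2r ?invr_gt0// exprS ler_piMl ?exprn_ge0 ?invr_ge0//.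
    by rewrite invf_le1// ler1n.
  rewrite /r in xn xn1 *; lra.
have /cvg_ex[l ul] := fV u incr.
apply/cvg_ex; exists l; apply/cvgrPdist_lt => e e0.
have e2 : 0 < e / 2 by rewrite divr_gt0.
have : \forall n \near \oo, r n < e / 2.
  have /cvgrPdist_lt/(_ _ e2) : r n @[n --> \oo] --> 0.
    rewrite -[X in _ --> X](mul0r (2^-1 : R)); apply: cvgMr_tmp.
    by apply: cvg_expr; rewrite ger0_norm ?invr_ge0// invf_lt1// ltr1n.
  apply: filterS => n; rewrite sub0r normrN gtr0_norm//.
move=> rn.
have /filter_ex[n [rne une]] : \forall n \near \oo, r n < e / 2 /\ `|l - u n| < e / 2.
  by apply: filterI => //; move/cvgrPdist_lt : ul; apply.
apply: filterS (Hu n) => x; rewrite -ball_normE /ball_/= => xn.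
rewrite -(subrKA (u n)) (le_lt_trans (ler_normD _ _))//; lra.
Qed.

Section hsum.
Context {V : normedModType R} {s : nat}.
Implicit Type z : hsum V s.

Lemma hsum_coord_le z j : `|z j| <= `|z|.
Proof.
rewrite hsum_normE -[leLHS]ger0_norm// -sqrtr_sqr ler_sqrt.
  by rewrite (bigD1 j)//= lerDl sumr_ge0// => i _; exact: sqr_ge0.
by apply: sumr_ge0 => i _; exact: sqr_ge0.
Qed.

Lemma hsum_norm_le_sum z : `|z| <= \sum_j `|z j|.
Proof.
have S0 : 0 <= \sum_j `|z j| by exact: sumr_ge0.
rewrite hsum_normE -[leRHS]ger0_norm// -sqrtr_sqr ler_sqrt ?sqr_ge0//.
rewrite expr2 mulr_suml; apply: ler_sum => j _.
rewrite expr2 ler_wpM2l// (bigD1 j)//= lerDl.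
exact: sumr_ge0.
Qed.

Lemma hsum_fast_complete : fast_complete V -> fast_complete (hsum V s).
Proof.
move=> fV u Hu.
have /choice[l Hl] (j : 'I_s) : exists l : V, u n j @[n --> \oo] --> l.
  apply/cvg_ex; apply: fV => n; apply: le_trans (Hu n).
  have := hsum_coord_le (u n.+1 - u n) j.
  by rewrite ffunE [X in `|_ + X|]ffunE.
apply/cvg_ex; exists [ffun j => l j].
apply/cvgrPdist_le => e e0.
have e1 : 0 < e / s.+1%:R by rewrite divr_gt0.
near=> n; apply: le_trans (hsum_norm_le_sum _) _.
apply: (@le_trans _ _ (\sum_(j < s) e / s.+1%:R)).
  apply: ler_sum => j _; rewrite !ffunE.
  suff H : forall i, `|l i - u n i| <= e / s.+1%:R by exact: H.
  near: n; apply: filter_forall => i.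
  by move/cvgrPdist_le : (Hl i); apply.
rewrite sumr_const card_ord -mulrnAr -mulr_natl ler_piMr// ?(ltW e0)//.
by rewrite ler_pdivrMr// mul1r ler_nat.
Unshelve. all: by end_near. Qed.

End hsum.
End fast_sequences.

Section L2_functions.
Context d (T : measurableType d) (R : realType).
Variable mu : {measure set T -> \bar R}.

Local Notation Lfun2 := (Lfun mu 2%:R%:E).
Local Notation L2fun := (LfunType mu (lee1n 2)).
Local Notation L2 := (Lp mu (lee1n 2)).

Let sqr_powR (x : R) : `|x| `^ 2%:R = x ^+ 2.
Proof. by rewrite powR_mulrn// real_normK ?num_real. Qed.

Lemma Lfun2P (f : T -> R) : measurable_fun setT f ->
  (\int[mu]_x ((f x) ^+ 2)%:E < +oo)%E -> f \in Lfun2.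
Proof.
move=> mf foo; rewrite inE; apply/andP; split; rewrite inE//= /finite_norm.
rewrite unlock /Lnorm poweR_lty//.
by under eq_integral do rewrite /= sqr_powR.
Qed.

Lemma Lfun2_measurable (f : T -> R) : f \in Lfun2 -> measurable_fun setT f.
Proof. by rewrite inE => /andP[]; rewrite inE. Qed.

Lemma Lfun2_le (f g : T -> R) : measurable_fun setT f -> g \in Lfun2 ->
  (forall x, `|f x| <= `|g x|) -> f \in Lfun2.
Proof.
move=> mf g2 fg; apply: Lfun2P => //.
have /integrableP[mg2 gfin] := Lfun2_integrable_sqr g2.
apply: le_lt_trans gfin; apply: ge0_le_integral => //.
- by move=> x _; rewrite lee_fin sqr_ge0.
- by apply/measurable_EFinP; exact: measurable_funX.
- exact: measurableT_comp.
move=> x _; rewrite /= lee_fin ger0_norm ?sqr_ge0//.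
rewrite -[leLHS]real_normK ?num_real// -[leRHS]real_normK ?num_real//.
by rewrite lerXn2r ?nnegrE.
Qed.

Lemma Lfun2_mul_integrable (f g : T -> R) : f \in Lfun2 -> g \in Lfun2 ->
  mu.-integrable setT (EFin \o (fun x => f x * g x)).
Proof. by move=> f2 g2; apply/Lfun1_integrable; exact: Lfun2_mul_Lfun1. Qed.

Lemma Lp_seminorm_sq (f : L2fun) : Lp_seminorm f ^+ 2 = \int[mu]_x (f x ^+ 2).
Proof.
apply: EFin_inj.
have nmE : (Lp_seminorm f)%:E = ('N[mu]_2%:R%:E[EFin \o f])%E.
  exact: finite_norm_fine.
rewrite -powR_mulrn ?Lp_seminorm_ge0// -poweR_EFin nmE powR_Lnorm//.
rewrite fineK.
  by apply: eq_integral => x _ /=; rewrite sqr_powR.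
have := Lfun2_integrable_sqr (LfunP f).
by move/integrable_fin_num; apply.
Qed.

Definition L2_of (f : T -> R) : L2 := Lp_class (insubd (0 : L2fun) f).

Lemma Lp_class_ae (f : L2fun) : {ae mu, forall x, Lp_repr (Lp_class f) x = f x}.
Proof.
have : Lp_seminorm (Lp_repr (Lp_class f) - f) = 0.
  by apply/Lp_classP; rewrite Lp_reprK.
move/fine_Lnormr_eq0; apply: filterS => x /(_ I) /eqP.
by rewrite subr_eq0 => /eqP.
Qed.

Lemma L2_of_ae (f : T -> R) : f \in Lfun2 ->
  {ae mu, forall x, Lp_repr (L2_of f) x = f x}.
Proof.
move=> f2; have := Lp_class_ae (insubd (0 : L2fun) f).
by apply: filterS => x ->; rewrite /insubd insubT.
Qed.

Lemma L2_repr_fun (z : L2) : (Lp_repr z : T -> R) \in Lfun2.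
Proof. exact: LfunP. Qed.

Lemma L2_measurable (z : L2) : measurable_fun setT (Lp_repr z).
Proof. exact: Lfun2_measurable (L2_repr_fun z). Qed.

Lemma L2_normsq (z : L2) : `|z| ^+ 2 = \int[mu]_x (Lp_repr z x ^+ 2).
Proof. exact: Lp_seminorm_sq. Qed.

Lemma L2_addE (y z : L2) :
  {ae mu, forall x, Lp_repr (y + z) x = Lp_repr y x + Lp_repr z x}.
Proof.
have := Lp_class_ae (Lp_repr y + Lp_repr z).
by rewrite Lp_classD !Lp_reprK.
Qed.

Lemma L2_scaleE a (z : L2) :
  {ae mu, forall x, Lp_repr (a *: z) x = a * Lp_repr z x}.
Proof. exact: (Lp_class_ae (a *: Lp_repr z)). Qed.

Lemma L2_subE (y z : L2) :
  {ae mu, forall x, Lp_repr (y - z) x = Lp_repr y x - Lp_repr z x}.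
Proof.
rewrite -scaleN1r; apply: filterS2 (L2_addE y (-1 *: z)) (L2_scaleE (-1) z).
by move=> x -> ->; rewrite mulN1r.
Qed.

Lemma ae_eq_Rintegral (f g : T -> R) :
  measurable_fun setT f -> measurable_fun setT g ->
  {ae mu, forall x, f x = g x} -> \int[mu]_x f x = \int[mu]_x g x.
Proof.
move=> mf mg fg; congr fine; apply: ae_eq_integral => //.
- exact/measurable_EFinP.
- exact/measurable_EFinP.
by apply: filterS fg => x -> _.
Qed.

Lemma L2_ext (y z : L2) :
  {ae mu, forall x, Lp_repr y x = Lp_repr z x} -> y = z.
Proof.
move=> yz; apply/eqP; rewrite -subr_eq0 -normr_eq0 -sqrf_eq0 L2_normsq.
rewrite (@ae_eq_Rintegral _ (cst 0)).
- by rewrite Rintegral_cst// mul0r.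
- by apply: measurable_funX; exact: L2_measurable.
- exact: measurable_cst.
by apply: filterS2 yz (L2_subE y z) => x -> ->; rewrite subrr expr0n.
Qed.

Definition L2_ip (y z : L2) : R := \int[mu]_x (Lp_repr y x * Lp_repr z x).

Lemma L2_ip_integrable (y z : L2) :
  mu.-integrable setT (EFin \o (fun x => Lp_repr y x * Lp_repr z x)).
Proof. exact: Lfun2_mul_integrable (L2_repr_fun _) (L2_repr_fun _). Qed.

Let mM (f g : T -> R) : measurable_fun setT f -> measurable_fun setT g ->
  measurable_fun setT (fun x => f x * g x).
Proof. exact: measurable_funM. Qed.

Lemma L2_inner_product : inner_product L2_ip.
Proof.
split.
- move=> a x y z; rewrite /L2_ip.
  rewrite -RintegralZl//; last exact: L2_ip_integrable.
  rewrite -RintegralD//.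
  + apply: ae_eq_Rintegral.
    * by apply: mM; exact: L2_measurable.
    * apply: measurable_funD; apply: mM => //; try exact: L2_measurable.
      by apply: mM; exact: L2_measurable.
    apply: filterS2 (L2_addE (a *: x) y) (L2_scaleE a x) => t -> ->.
    by rewrite mulrDl mulrA.
  + by apply: eq_integrable (integrableZl measurableT a (L2_ip_integrable x z)).
  + exact: L2_ip_integrable.
- by move=> x y; apply: eq_Rintegral => t _; rewrite mulrC.
- by move=> x; rewrite L2_normsq; apply: eq_Rintegral => t _; rewrite expr2.
Qed.

Definition L2_neg (z : L2) : L2 := L2_of (fun x => Num.max (- Lp_repr z x) 0).

Lemma L2_negE (z : L2) :
  {ae mu, forall x, Lp_repr (L2_neg z) x = Num.max (- Lp_repr z x) 0}.
Proof.
apply: L2_of_ae; apply: Lfun2_le (L2_repr_fun z) _ => [|x].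
  apply: measurable_maxr; last exact: measurable_cst.
  by apply: measurableT_comp => //; exact: L2_measurable.
rewrite ger0_norm ?le_max ?lexx ?orbT// ge_max normr_ge0 andbT.
by rewrite -normrN ler_norm.
Qed.

Lemma L2_ip_le (w z y y' : L2) :
  {ae mu, forall x, Lp_repr w x * Lp_repr z x <= Lp_repr y x * Lp_repr y' x} ->
  L2_ip w z <= L2_ip y y'.
Proof.
move=> H; rewrite -subr_ge0 /L2_ip -RintegralB//; try exact: L2_ip_integrable.
rewrite (@ae_eq_Rintegral _ (fun x =>
    `|Lp_repr y x * Lp_repr y' x - Lp_repr w x * Lp_repr z x|)).
- by apply: Rintegral_ge0.
- by apply: measurable_funB; apply: mM; exact: L2_measurable.
- apply: measurableT_comp => //.
  by apply: measurable_funB; apply: mM; exact: L2_measurable.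
by apply: filterS H => x wz; rewrite ger0_norm// subr_ge0.
Qed.

Lemma L2_negative_part : negative_part L2_ip L2_neg.
Proof.
have ipP := L2_inner_product; split=> [z|z w].
  have [_ _ <-] := ipP; rewrite -(ipNl ipP) /L2_ip.
  apply: ae_eq_Rintegral.
  - by apply: mM; exact: L2_measurable.
  - by apply: mM; exact: L2_measurable.
  have := L2_scaleE (-1) (L2_neg z); rewrite scaleN1r => Nz.
  apply: filterS2 Nz (L2_negE z) => x -> ->.
  by rewrite mulN1r; case: leP => _; rewrite ?mulr0 ?oppr0 ?mul0r// opprK.
rewrite -(ipNl ipP); apply: L2_ip_le.
have := L2_scaleE (-1) z; rewrite scaleN1r => Nz.
apply: filterS3 Nz (L2_negE z) (L2_negE w) => x -> -> ->.
by rewrite mulN1r ler_wpM2r// le_max lexx ?orbT.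
Qed.

Lemma L2_neg_eq0 (z : L2) :
  (`|L2_neg z| = 0) <-> {ae mu, forall x, 0 <= Lp_repr z x}.
Proof.
have zeroE : {ae mu, forall x, Lp_repr (0 : L2) x = 0}.
  have := L2_scaleE 0 (0 : L2); rewrite scale0r.
  by apply: filterS => x; rewrite mul0r.
split=> [/normr0_eq0 z0|z0].
  have := L2_negE z; rewrite z0; apply: filterS2 zeroE => x ->.
  case: (leP (- Lp_repr z x) 0) => [|Nz0 E]; first by rewrite oppr_le0.
  by rewrite -E ltxx in Nz0.
rewrite (_ : L2_neg z = 0) ?normr0//; apply: L2_ext.
apply: filterS3 z0 zeroE (L2_negE z) => x zx -> ->.
by apply/max_idPr; rewrite oppr_le0.
Qed.

Lemma L2_distE (y z : L2) :
  (\int[mu]_x ((Lp_repr y x - Lp_repr z x) ^+ 2)%:E = (`|y - z| ^+ 2)%:E)%E.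
Proof.
rewrite L2_normsq fineK; last first.
  exact: (integrable_fin_num _ (Lfun2_integrable_sqr (L2_repr_fun (y - z)))).
apply: ae_eq_integral => //.
- apply/measurable_EFinP; apply: measurable_funX.
  by apply: measurable_funB; exact: L2_measurable.
- by apply/measurable_EFinP; apply: measurable_funX; exact: L2_measurable.
by apply: filterS (L2_subE y z) => x -> _.
Qed.

Let geo_le n : \sum_(0 <= k < n) (4^-1 : R) ^+ k <= 2 - 2 * 4^-1 ^+ n.
Proof.
elim: n => [|n IH]; first by rewrite big_geq// expr0; lra.
rewrite big_nat_recr//= exprS.
have : 0 <= (4^-1 : R) ^+ n by rewrite exprn_ge0.
lra.
Qed.

Let fast_tail (z : nat -> L2) n j :
  (forall n, `|z n.+1 - z n| <= 4^-1 ^+ n) ->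
  `|z (n + j)%N - z n| <= 2 * 4^-1 ^+ n - 2 * 4^-1 ^+ (n + j).
Proof.
move=> zf; elim: j => [|j IH]; first by rewrite addn0 !subrr normr0.
rewrite addnS -(subrKA (z (n + j)%N)) (le_trans (ler_normD _ _))//.
have := zf (n + j)%N; rewrite exprS.
have : 0 <= (4^-1 : R) ^+ (n + j) by rewrite exprn_ge0.
lra.
Qed.

(* With [a n] the increments, the sum of [4^n * (a n)^2] is integrable, hence
   finite almost everywhere, and dominates the sum of [|a n|] by AM-GM. *)
Let fast_cvg_ae (z : nat -> L2) :
  (forall n, `|z n.+1 - z n| <= 4^-1 ^+ n) ->
  {ae mu, forall x, cvg (Lp_repr (z n) x @[n --> \oo])}.
Proof.
move=> zf; pose a n x := Lp_repr (z n.+1) x - Lp_repr (z n) x.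
have ma n : measurable_fun setT (a n).
  by apply: measurable_funB; exact: L2_measurable.
pose G n x := ((4 ^+ n) * (a n x) ^+ 2)%:E.
have mG n : measurable_fun setT (G n).
  apply/measurable_EFinP; apply: measurable_funM => //.
  exact: measurable_funX.
have G0 n x : (0 <= G n x)%E by rewrite lee_fin mulr_ge0 ?sqr_ge0 ?exprn_ge0.
pose H x := (\sum_(n <oo) G n x)%E.
have mH : measurable_fun setT H by apply: ge0_emeasurable_sum.
have intG n : (\int[mu]_x G n x <= (4^-1 ^+ n)%:E)%E.
  rewrite /G; under eq_integral do rewrite EFinM.
  rewrite ge0_integralZl//; last 2 first.
  - by apply/measurable_EFinP; exact: measurable_funX.
  - by move=> x _; rewrite lee_fin sqr_ge0.
  rewrite L2_distE -EFinM lee_fin.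
  apply: (@le_trans _ _ (4 ^+ n * (4^-1 ^+ n) ^+ 2)).
    by rewrite ler_wpM2l ?exprn_ge0// lerXn2r ?nnegrE ?exprn_ge0.
  by rewrite expr2 exprVn mulrA mulfV ?mul1r// expf_neq0.
have intH : mu.-integrable setT H.
  apply/integrableP; split => //.
  under eq_integral do rewrite gee0_abs ?nneseries_ge0//.
  rewrite /H integral_nneseries//.
  apply: (@le_lt_trans _ _ 2%:E); last exact: ltry.
  apply: lime_le.
    by apply: is_cvg_nneseries => n _ _; exact: integral_ge0.
  near=> n; apply: (@le_trans _ _ (\sum_(0 <= k < n) (4^-1 ^+ k)%:E)%E).
    by apply: lee_sum => k _; exact: intG.
  rewrite sumEFin lee_fin (le_trans (geo_le n))// gerBl.
  by rewrite mulr_ge0// exprn_ge0.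
apply: filterS (integrable_ae measurableT intH) => x /(_ I) Hfin.
pose u n := Lp_repr (z n) x.
have Ha : cvgn (series (telescope u)).
  apply: normed_cvg; apply: nondecreasing_is_cvgn.
    by apply: nondecreasing_series => k _ _; exact: normr_ge0.
  exists ((fine (H x) + 2) / 2) => _ [n _ <-].
  have Hn : \sum_(0 <= k < n) (4 ^+ k * (a k x) ^+ 2) <= fine (H x).
    rewrite -lee_fin fineK// -sumEFin.
    by apply: (@nneseries_lim_ge _ (G ^~ x) xpredT 0%N n) => k _ _; exact: G0.
  rewrite /series/= ler_pdivlMr//.
  apply: (@le_trans _ _ (\sum_(0 <= k < n) (4 ^+ k * (a k x) ^+ 2 + 4^-1 ^+ k))).
    rewrite mulr_suml; apply: ler_sum => k _.
    rewrite (_ : telescope u k = a k x)//.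
    have p0 : 0 < 4 ^+ k :> R by rewrite exprn_gt0.
    rewrite exprVn -[(a k x) ^+ 2]real_normK ?num_real//.
    move: (4 ^+ k) p0 `|a k x| => p p0 b.
    have : 0 <= p^-1 * (p * b - 1) ^+ 2 by rewrite mulr_ge0 ?invr_ge0 ?sqr_ge0 ?ltW.
    suff -> : p^-1 * (p * b - 1) ^+ 2 = p * b ^+ 2 + p^-1 - b * 2 by rewrite subr_ge0.
    by field; rewrite gt_eqF.
  rewrite big_split/= lerD// (le_trans (geo_le n))// gerBl.
  by rewrite mulr_ge0// exprn_ge0.
rewrite telescopeK in Ha.
have -> : (fun n => Lp_repr (z n) x) = (fun n => (u n - u 0%N) + u 0%N).
  by apply/funext => n; rewrite subrK.
by apply: is_cvgD => //; exact: is_cvg_cst.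
Unshelve. all: by end_near. Qed.

Lemma L2_fast_complete : fast_complete L2.
Proof.
move=> z zf; pose f x := fine (limn_esup (fun n => (Lp_repr (z n) x)%:E)).
have mf : measurable_fun setT f.
  apply: measurableT_comp; first exact: measurable_realfun.fine_measurable.
  apply: measurable_fun_limn_esup => n; apply/measurable_EFinP.
  exact: L2_measurable.
have flim : {ae mu, forall x, Lp_repr (z n) x @[n --> \oo] --> f x}.
  apply: filterS (fast_cvg_ae zf) => x /cvg_ex[l ul].
  have lim : (Lp_repr (z n) x)%:E @[n --> \oo] --> l%:E.
    by apply: cvg_EFin; [exact: nearW|exact: ul].
  by rewrite /f (cvg_limn_einf_sup lim).2.
have mfz n : measurable_fun setT (fun x => f x - Lp_repr (z n) x).
  by apply: measurable_funB => //; exact: L2_measurable.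
have close n : (\int[mu]_x ((f x - Lp_repr (z n) x) ^+ 2)%:E
    <= ((2 * 4^-1 ^+ n) ^+ 2)%:E)%E.
  pose w m x := ((Lp_repr (z m) x - Lp_repr (z n) x) ^+ 2)%:E.
  have mw m : measurable_fun setT (w m).
    apply/measurable_EFinP; apply: measurable_funX.
    by apply: measurable_funB; exact: L2_measurable.
  apply: (@le_trans _ _ (\int[mu]_x limn_einf (w^~ x))%E); last first.
    apply: le_trans (fatou mu measurableT mw _) _.
      by move=> m x _; rewrite lee_fin sqr_ge0.
    apply: limn_einf_le; exists n => // m /= nm.
    rewrite /w L2_distE lee_fin lerXn2r ?nnegrE ?mulr_ge0 ?exprn_ge0//.
    rewrite -(subnKC nm) (le_trans (fast_tail _ _ zf))// gerBl.
    by rewrite mulr_ge0// exprn_ge0.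
  apply: ae_ge0_le_integral => //.
  - by move=> x _; rewrite lee_fin sqr_ge0.
  - by apply/measurable_EFinP; exact: measurable_funX.
  - move=> x _; rewrite limn_einf_lim; apply: lime_ge; first exact: is_cvg_einfs.
    by near=> m; apply: le_ereal_inf_tmp => _ [k _ <-]; rewrite lee_fin sqr_ge0.
  - rewrite (_ : (fun _ => _) = -%E \o (fun x => limn_esup ((-%E \o (w^~ x))))).
      apply: measurableT_comp => //; apply: measurable_fun_limn_esup => m.
      exact: measurableT_comp.
    by apply/funext => x /=; rewrite limn_esupN oppeK.
  apply: filterS flim => x fx _.
  have lim : (w m x @[m --> \oo] --> ((f x - Lp_repr (z n) x) ^+ 2)%:E).
    apply: cvg_EFin; first exact: nearW.
    have fz : Lp_repr (z m) x - Lp_repr (z n) x @[m --> \oo] --> f x - Lp_repr (z n) x.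
      by apply: cvgB; [exact: fx|exact: cvg_cst].
    by apply: (cvgM fz fz).
  by have [-> _] := cvg_limn_einf_sup lim.
have f2 : f \in Lfun2.
  have -> : f = (fun x => f x - Lp_repr (z 0%N) x) + (Lp_repr (z 0%N) : T -> R).
    by apply/funext => x; rewrite /GRing.add/= subrK.
  apply: (@Lfun_addr_closed _ _ _ mu _ (lee1n 2)).2; last exact: L2_repr_fun.
  by apply: Lfun2P => //; apply: le_lt_trans (close 0%N) (ltry _).
apply/cvg_ex; exists (L2_of f); apply/cvgrPdist_le => e e0.
have : \forall n \near \oo, 2 * 4^-1 ^+ n <= e :> R.
  have /cvgrPdist_le/(_ _ e0) : 2 * 4^-1 ^+ n @[n --> \oo] --> (0 : R).
    rewrite -[X in _ --> X](mulr0 (2 : R)); apply: cvgMl_tmp.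
    by apply: cvg_expr; rewrite ger0_norm ?invr_ge0// invf_lt1// ltr1n.
  by apply: filterS => n; rewrite sub0r normrN ger0_norm ?mulr_ge0 ?exprn_ge0.
apply: filterS => n; apply: le_trans.
rewrite -ler_sqr ?nnegrE ?mulr_ge0 ?exprn_ge0//.
rewrite -lee_fin -L2_distE; apply: le_trans (close n).
rewrite le_eqVlt; apply/orP; left; apply/eqP.
apply: ae_eq_integral => //.
- apply/measurable_EFinP; apply: measurable_funX.
  by apply: measurable_funB; exact: L2_measurable.
- by apply/measurable_EFinP; exact: measurable_funX.
by apply: filterS (L2_of_ae f2) => x -> _.
Unshelve. all: by end_near. Qed.

End L2_functions.

Section hsum_positive.
Context {R : realType} {V : normedModType R} {s : nat}.
Variables (ip : V -> V -> R) (neg : V -> V).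
Hypotheses (ipP : inner_product ip) (negP : negative_part ip neg).

Definition hsum_ip (y z : hsum V s) : R := \sum_j ip (y j) (z j).

Definition hsum_neg (z : hsum V s) : hsum V s := [ffun j => neg (z j)].

Lemma hsum_normsq (z : hsum V s) : `|z| ^+ 2 = \sum_j `|z j| ^+ 2.
Proof.
by rewrite hsum_normE sqr_sqrtr// sumr_ge0// => j _; exact: sqr_ge0.
Qed.

Lemma hsum_inner_product : inner_product hsum_ip.
Proof.
have [lip sip ip2] := ipP; split.
- move=> a x y z; rewrite /hsum_ip mulr_sumr -big_split/=.
  by apply: eq_bigr => j _; rewrite ffunE [X in ip (X + _)]ffunE lip.
- by move=> x y; apply: eq_bigr => j _.
- by move=> x; rewrite hsum_normsq; apply: eq_bigr => j _.
Qed.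

Lemma hsum_negative_part : negative_part hsum_ip hsum_neg.
Proof.
have [n1 n2] := negP; split=> [z|z w].
  by rewrite hsum_normsq -sumrN; apply: eq_bigr => j _; rewrite ffunE n1.
by rewrite /hsum_ip -sumrN; apply: ler_sum => j _; rewrite !ffunE n2.
Qed.

Lemma hsum_neg_eq0 (z : hsum V s) :
  `|hsum_neg z| = 0 <-> forall j, `|neg (z j)| = 0.
Proof.
split=> [z0 j|z0].
  have := hsum_coord_le (hsum_neg z) j; rewrite z0 ffunE => zj.
  by apply/eqP; rewrite eq_le zj normr_ge0.
apply/eqP; rewrite eq_le normr_ge0 andbT (le_trans (hsum_norm_le_sum _))//.
by rewrite big1// => j _; rewrite ffunE z0.
Qed.

End hsum_positive.

(** * Functions on a bounded domain *)

Section lebesgue_rV_functions.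
Context {R : realType} {m : nat}.

Lemma rV_coord_le (v : 'rV[R]_m) i : `|v ord0 i| <= `|v|.
Proof.
have /mapP[j Hj ->] : `|v ord0 i| \in [seq `|v x.1 x.2| | x : 'I_1 * 'I_m].
  by apply/mapP; exists (ord0, i) => //=; rewrite mem_enum.
by rewrite [leRHS]/Num.norm/= mx_normrE; apply/bigmax_geP; right => /=; exists j.
Qed.

Definition cube (M : R) : set 'rV[R]_m :=
  [set v | forall i, v ord0 i \in `[- M, M]].

Lemma bounded_cube (A : set 'rV[R]_m) : bounded_set A -> exists M, A `<=` cube M.
Proof.
move=> [M [Mreal AM]]; exists (M + 1) => v Av i.
rewrite in_itv/= -ler_norml (le_trans (rV_coord_le v i))//.
by apply: AM Av; rewrite ltrDl.
Qed.

Lemma cube_compact (M : R) : compact (cube M).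
Proof.
apply: (@rV_compact _ _ (fun=> `[- M, M]%classic)) => _.
exact: segment_compact.
Qed.

Lemma cube_measurable M : measurable (cube M).
Proof.
have -> : cube M = \bigcap_(i in [set: 'I_m])
    ((fun x : 'rV[R]_m => x 0 i) @^-1` `[- M, M]).
  by apply/seteqP; split=> x /= H i; [move=> _|]; exact: H.
apply: fin_bigcap_measurable; first exact: finite_finset.
move=> i _; rewrite -[X in measurable X]setTI.
by apply: measurable_rV_coord => //; exact: measurable_itv.
Qed.

Lemma continuous_measurable_rV (f : 'rV[R]_m -> R) :
  continuous f -> measurable_fun setT f.
Proof.
move=> cf; apply: (measurability _ (RGenOpens.measurableE R)).
move=> _ [_ [a [b ->] <-]]; rewrite setTI; apply: open_measurable_rV.
by apply: open_comp => [x _|]; [exact: cf|exact: interval_open].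
Qed.

Lemma continuous_cube_bounded (f : 'rV[R]_m -> R) M : continuous f ->
  exists C, forall x, cube M x -> `|f x| <= C.
Proof.
move=> cf.
have fM : {within cube M, continuous f} by exact: continuous_subspaceT.
have [C [_ HC]] := compact_bounded (continuous_compact fM (@cube_compact M)).
by exists (C + 1) => x Mx; apply: (HC (C + 1)); [rewrite ltrDl ltr01|exists x].
Qed.

End lebesgue_rV_functions.

Lemma cube_lebesgue_finite {R : realType} m (M : R) :
  (lebesgue_rV m (cube M) < +oo)%E.
Proof.
elim: m => [|m IH].
  by rewrite /= diracE; case: (_ \in _); rewrite ltry.
rewrite /= /cons_measure /pushforward.
apply: (@le_lt_trans _ _ ((@lebesgue_measure R \x lebesgue_rV m)%E
    (`[- M, M]%classic `*` cube M))).
  apply: le_measure; rewrite ?inE.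
  - rewrite -[X in measurable X]setTI; apply: measurable_cons_rV => //.
    exact: cube_measurable.
  - by apply: measurableX; [exact: measurable_itv|exact: cube_measurable].
  move=> [a v] /= H; split => [|i] /=.
    have := H ord0; rewrite /cons_rV.
    have -> : ord0 = @lshift 1 m ord0 :> 'I_m.+1 by exact: val_inj.
    by rewrite (@row_mxEl _ 1 1 m) mxE eqxx mulr1n.
  have := H (@rshift 1 m i); rewrite /cons_rV.
  by rewrite (@row_mxEr _ 1 1 m).
rewrite product_measure1E//; last exact: cube_measurable.
apply: lte_mul_pinfty => //.
rewrite ge0_fin_numE//.
pose I := `[- M, M]%classic : set R.
suff : (lebesgue_measure I < +oo)%E by [].
by rewrite /I lebesgue_measure_itv/=; case: ifP => _; rewrite ?ltry.
Qed.

Section L2_bounded_domain.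
Context {R : realType} {m : nat} {Om : set 'rV[R]_m} (oOm : open Om).
Hypothesis bOm : bounded_set Om.
Local Notation mu := (lebesgue_on oOm).

Lemma lebesgue_on_finite : (mu setT < +oo)%E.
Proof.
have [M OmM] := bounded_cube bOm.
rewrite /= /mrestr setTI; apply: le_lt_trans (cube_lebesgue_finite m M).
apply: le_measure => //; rewrite inE.
  exact: open_measurable_rV.
exact: cube_measurable.
Qed.

Lemma lebesgue_on_ae : {ae mu, forall x, Om x}.
Proof.
exists (~` Om); split.
- by apply: measurableC; exact: open_measurable_rV.
- by rewrite /= /mrestr setICl measure0.
- by [].
Qed.

Lemma continuous_Lfun2 (f : 'rV[R]_m -> R) : continuous f ->
  f \in Lfun mu 2%:R%:E.
Proof.
move=> cf; have [M OmM] := bounded_cube bOm.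
have [C HC] := continuous_cube_bounded M cf.
have mf := continuous_measurable_rV cf.
apply: Lfun2P => //.
apply: (@le_lt_trans _ _ (\int[mu]_x (C ^+ 2)%:E)%E); last first.
  by rewrite integral_cst// lte_mul_pinfty ?lee_fin ?sqr_ge0 ?lebesgue_on_finite.
apply: ae_ge0_le_integral => //.
- by move=> x _; rewrite lee_fin sqr_ge0.
- by apply/measurable_EFinP; exact: measurable_funX.
- by move=> x _; rewrite lee_fin sqr_ge0.
apply: filterS lebesgue_on_ae => x Omx _.
rewrite lee_fin -[f x ^+ 2]real_normK ?num_real// lerXn2r ?nnegrE//.
  by rewrite (le_trans _ (HC _ (OmM _ Omx))).
exact: HC (OmM _ Omx).
Qed.

End L2_bounded_domain.

Section smoothness.
Context {R : realType}.

Lemma continuous_addf {T : topologicalType} (f g : T -> R) :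
  continuous f -> continuous g -> continuous (fun x => f x + g x).
Proof. by move=> cf cg x; apply: cvgD; [exact: cf|exact: cg]. Qed.

Lemma continuous_mulf {T : topologicalType} (f g : T -> R) :
  continuous f -> continuous g -> continuous (fun x => f x * g x).
Proof. by move=> cf cg x; apply: cvgM; [exact: cf|exact: cg]. Qed.

Lemma continuous_invf {T : topologicalType} (f : T -> R) :
  (forall x, f x != 0) -> continuous f -> continuous (fun x => (f x)^-1).
Proof. by move=> f0 cf x; apply: cvgV; [exact: f0|exact: cf]. Qed.

Lemma continuous_sqrtf {T : topologicalType} (f : T -> R) :
  continuous f -> continuous (fun x => Num.sqrt (f x)).
Proof.
by move=> cf x; apply: (continuous_comp (cf x)); exact: sqrt_continuous.
Qed.

Lemma is_derive1P (V : normedModType R) (f : V -> R) (x v : V) (df : R) :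
  is_derive x v f df <-> is_derive (0 : R) 1 (fun h : R => f (h *: v + x)) df.
Proof.
have E : 'D_v f x = 'D_1 (fun h : R => f (h *: v + x)) 0.
  rewrite /derive; set g1 := fun h => h^-1 *: _; set g2 := fun h => h^-1 *: _.
  suff -> : g1 = g2 by [].
  by apply/funext => h; rewrite /g1 /g2/= addr0 scale0r add0r [_%:A]mulr1.
split=> -[df1 df2]; apply: DeriveDef.
- by apply: (derivable1P f x v).1.
- by rewrite -E.
- by apply: (derivable1P f x v).2.
- by rewrite E.
Qed.

Lemma is_derive_comp1 (V : normedModType R) (f : R -> R) (g : V -> R)
    (x v : V) (df dg : R) :
  is_derive (g x) 1 f df -> is_derive x v g dg ->
  is_derive x v (f \o g) (df * dg).
Proof.
move=> fd /is_derive1P gd; apply/is_derive1P.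
apply: (@is_derive1_comp _ f (fun h => g (h *: v + x))) => //.
by rewrite scale0r add0r.
Qed.

Context {m : nat} {phi : 'rV[R]_m -> R} (e : R).
Hypotheses (sphi : smooth phi) (e0 : 0 < e).

Let root x := Num.sqrt (phi x ^+ 2 + e ^+ 2).

Let root_gt0 x : 0 < root x.
Proof. by rewrite sqrtr_gt0 ltr_wpDl ?sqr_ge0// exprn_gt0. Qed.

(* An algebra that contains [negreg \o phi] below and is closed under partial
   derivatives, which yields smoothness by induction. *)
Inductive regular : ('rV[R]_m -> R) -> Prop :=
| regular_pderiv al : regular (foldr (@pderiv R m) phi al)
| regular_cst c : regular (cst c)
| regular_root : regular root
| regular_invroot : regular (fun x => (root x)^-1)
| regularD f g : regular f -> regular g -> regular (f + g)
| regularM f g : regular f -> regular g -> regular (f * g).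

Let e_ (i : 'I_m) : 'rV[R]_m := delta_mx 0 i.

Let phi_is_derive i x : is_derive x (e_ i) phi (pderiv i phi x).
Proof. by apply: DeriveDef => //; have [_ +] := sphi [::]; apply. Qed.

Let root_is_derive i x : is_derive x (e_ i) root ((root x)^-1 * phi x * pderiv i phi x).
Proof.
pose g x := phi x ^+ 2 + e ^+ 2.
have g0 : 0 < g x by rewrite ltr_wpDl ?sqr_ge0// exprn_gt0.
have dg : is_derive x (e_ i) g (2 * phi x * pderiv i phi x).
  have -> : g = phi * phi + cst (e ^+ 2) by apply/funext => y; rewrite /g expr2.
  have := phi_is_derive i x => H.
  apply: (is_derive_eq (is_deriveD (is_deriveM H H) (is_derive_cst _ _ _))).
  by rewrite addr0 /GRing.scale/=; ring.
apply: (is_derive_eq (is_derive_comp1 (is_derive1_sqrt g0) dg)).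
by rewrite -/(root x); field; rewrite gt_eqF.
Qed.

Let invroot_is_derive i x : is_derive x (e_ i) (fun y => (root y)^-1)
  (- ((root x)^-1 * (root x)^-1 * ((root x)^-1 * phi x * pderiv i phi x))).
Proof.
have [d1 d2] := root_is_derive i x.
apply: DeriveDef; first by apply: derivableV => //; rewrite gt_eqF.
rewrite deriveV ?gt_eqF// d2 /GRing.scale/= mulNr; congr (- _).
by rewrite -exprVn expr2.
Qed.

Let regular_is_derive f : regular f -> continuous f /\
  forall i, (forall x, derivable f x (e_ i)) /\ regular (pderiv i f).
Proof.
have rphi : regular phi by exact: (regular_pderiv [::]).
have rdphi i : regular (pderiv i phi) by exact: (regular_pderiv [:: i]).
have rroot := regular_root; have rinv := regular_invroot.
have cphi : continuous phi by have [] := sphi [::].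
have croot : continuous root.
  apply: continuous_sqrtf; apply: continuous_addf; last exact: cst_continuous.
  exact: continuous_mulf.
elim=> {f} [al|c||| f g rf [cf Hf] rg [cg Hg]|f g rf [cf Hf] rg [cg Hg]].
- have [ca da] := sphi al; split => // i; split; first exact: da.
  exact: (regular_pderiv (i :: al)).
- split; first exact: cst_continuous.
  move=> i; split; first by move=> x; exact: derivable_cst.
  rewrite (_ : pderiv _ _ = cst 0); first exact: regular_cst.
  by apply/funext => x; rewrite /pderiv derive_cst.
- split=> // i; split; first by move=> x; have [] := root_is_derive i x.
  rewrite (_ : pderiv _ _ = (fun x => (root x)^-1) * phi * pderiv i phi).
    by do 2 apply: regularM => //.
  by apply/funext => x; have [_] := root_is_derive i x.
- split; first by apply: continuous_invf => // x; rewrite gt_eqF.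
  move=> i; split; first by move=> x; have [] := invroot_is_derive i x.
  rewrite (_ : pderiv _ _ = cst (-1) * ((fun x => (root x)^-1) *
    (fun x => (root x)^-1) * ((fun x => (root x)^-1) * phi * pderiv i phi))).
    apply: regularM; first exact: regular_cst.
    by do 2 (apply: regularM; try by apply: regularM => //) => //.
  apply/funext => x; have [_ H] := invroot_is_derive i x.
  by rewrite /pderiv H [RHS]mulN1r.
- split; first exact: continuous_addf.
  move=> i; have [df rdf] := Hf i; have [dg rdg] := Hg i.
  split; first by move=> x; exact: derivableD.
  rewrite (_ : pderiv _ _ = pderiv i f + pderiv i g); first exact: regularD.
  by apply/funext => x; rewrite /pderiv deriveD.
split; first exact: continuous_mulf.
move=> i; have [df rdf] := Hf i; have [dg rdg] := Hg i.
split; first by move=> x; exact: derivableM.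
rewrite (_ : pderiv _ _ = f * pderiv i g + g * pderiv i f).
  by apply: regularD; exact: regularM.
by apply/funext => x; rewrite /pderiv deriveM.
Qed.

Lemma regular_smooth f : regular f -> smooth f.
Proof.
move=> rf al; suff ral : regular (foldr (@pderiv R m) f al).
  have [ca Ha] := regular_is_derive ral; split => // i x.
  by have [] := Ha i.
by elim: al => //= i al /regular_is_derive[_ /(_ i)[]].
Qed.

(* A smooth approximation of minus the negative part; it vanishes at [0], so
   that composition with it preserves test functions. *)
Definition negreg (t : R) : R := (t - Num.sqrt (t ^+ 2 + e ^+ 2) + e) / 2.

Definition negreg' (t : R) : R := (1 - t / Num.sqrt (t ^+ 2 + e ^+ 2)) / 2.

Lemma negreg_smooth : smooth (negreg \o phi).
Proof.
apply: regular_smooth.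
have -> : negreg \o phi = cst 2^-1 * (phi + cst (-1) * root + cst e).
  apply/funext => x; rewrite /negreg/= [RHS]/GRing.mul/= /GRing.add/=.
  by rewrite mulrC mulN1r.
have rphi : regular phi by exact: (regular_pderiv [::]).
apply: regularM; first exact: regular_cst.
apply: regularD; last exact: regular_cst.
by apply: regularD => //; apply: regularM; [exact: regular_cst|exact: regular_root].
Qed.

Lemma pderiv_negreg i x : pderiv i (negreg \o phi) x =
  negreg' (phi x) * pderiv i phi x.
Proof.
have -> : negreg \o phi = cst 2^-1 * (phi + cst (-1) * root + cst e).
  apply/funext => y; rewrite /negreg/= [RHS]/GRing.mul/= /GRing.add/=.
  by rewrite mulrC mulN1r.
have c (a : R) : is_derive x (e_ i) (cst a) 0 by exact: is_derive_cst.
have [_ H] := is_deriveM (c 2^-1) (is_deriveD (is_deriveD (phi_is_derive i x)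
  (is_deriveM (c (-1)) (root_is_derive i x))) (c e)).
rewrite /pderiv H /GRing.scale/= /negreg' -/(root x) /pderiv.
by field; rewrite gt_eqF.
Qed.

Lemma negreg0 : negreg 0 = 0.
Proof. by rewrite /negreg expr0n/= !add0r sqrtr_sqr gtr0_norm// addNr mul0r. Qed.

Let sq t := Num.sqrt (t ^+ 2 + e ^+ 2).

Let sq_gt0 t : 0 < sq t.
Proof. by rewrite sqrtr_gt0 ltr_wpDl ?sqr_ge0// exprn_gt0. Qed.

Let sq_ge t : `|t| <= sq t.
Proof. by rewrite -sqrtr_sqr ler_sqrt ?addr_ge0 ?sqr_ge0// lerDl sqr_ge0. Qed.

Let sq_ge_e t : e <= sq t.
Proof.
rewrite -[leLHS]gtr0_norm// -sqrtr_sqr ler_sqrt ?addr_ge0 ?sqr_ge0//.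
by rewrite lerDr sqr_ge0.
Qed.

Let sq_le t : sq t <= `|t| + e.
Proof.
have te0 : 0 <= `|t| + e by rewrite addr_ge0// ltW.
rewrite -[leRHS]ger0_norm// -sqrtr_sqr ler_sqrt ?sqr_ge0//.
rewrite sqrrD real_normK ?num_real// -addrA lerD2l lerDr.
by rewrite mulrn_wge0// mulr_ge0// ltW.
Qed.

Lemma negreg_close t : `|negreg t + Num.max (- t) 0| <= e.
Proof.
have := sq_ge t; have := sq_le t; rewrite /negreg -/(sq t) => h1 h2.
rewrite ler_norml; case: (leP (- t) 0) => t0.
  move: h1 h2; rewrite ger0_norm; last by rewrite -oppr_le0.
  by move=> h1 h2; apply/andP; split; lra.
move: h1 h2; rewrite ltr0_norm; last by rewrite -oppr_gt0.
by move=> h1 h2; apply/andP; split; lra.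
Qed.

Lemma negreg_young (k u eta A P Q : R) : 0 < k -> 0 < u -> 0 < eta ->
  0 <= k * eta / 2 * A ^+ 2 + k / (2 * eta) * (A - Q) ^+ 2
     + u ^+ 2 / (2 * k) * (Num.max (- P) 0) ^+ 2
     + u * e / 2 * (A ^+ 2 + 1)
     + k * (A * (negreg' P * Q)) + u * (A * negreg P).
Proof.
move=> k0 u0 eta0.
have g0 : 0 <= negreg' P.
  rewrite /negreg' divr_ge0// subr_ge0 ler_pdivrMr ?sq_gt0// mul1r.
  exact: le_trans (ler_norm P) (sq_ge P).
have g1 : negreg' P <= 1.
  rewrite /negreg' ler_pdivrMr// mul1r lerBlDr -lerBlDl.
  rewrite (_ : 1 - 2 = -1); last by ring.
  rewrite ler_pdivlMr ?sq_gt0// mulN1r lerNl.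
  by rewrite (le_trans _ (sq_ge P))// -normrN ler_norm.
have main : 0 <= k * eta / 2 * A ^+ 2 + k / (2 * eta) * (A - Q) ^+ 2
    - k * (negreg' P * (A * (A - Q))).
  have -> : k * eta / 2 * A ^+ 2 + k / (2 * eta) * (A - Q) ^+ 2
      - k * (negreg' P * (A * (A - Q))) = k / (2 * eta) *
      ((eta * A - negreg' P * (A - Q)) ^+ 2 +
       (1 - negreg' P ^+ 2) * (A - Q) ^+ 2).
    by field; rewrite gt_eqF.
  rewrite mulr_ge0 ?divr_ge0 ?(ltW k0) ?mulr_ge0 ?(ltW eta0)//.
  by rewrite addr_ge0 ?sqr_ge0// mulr_ge0 ?sqr_ge0// subr_ge0 expr_le1.
suff : 0 <= k * negreg' P * A ^+ 2 + u ^+ 2 / (2 * k) * (Num.max (- P) 0) ^+ 2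
    + u * e / 2 * (A ^+ 2 + 1) + u * (A * negreg P).
  move: main; move: (k * eta / 2) (k / (2 * eta)) (u ^+ 2 / (2 * k)).
  move=> c1 c2 c3; nra.
have bnd := negreg_close P.
have [P0|P0] := leP (- P) 0.
  move: bnd; rewrite (max_idPr P0) addr0 expr0n mulr0 addr0 => bnd.
  have : 0 <= k * negreg' P * A ^+ 2 by rewrite mulr_ge0 ?sqr_ge0// mulr_ge0// ltW.
  have H : `|A * negreg P| <= e / 2 * (A ^+ 2 + 1).
    rewrite normrM (le_trans (ler_wpM2l (normr_ge0 A) bnd))//.
    rewrite -[A ^+ 2]real_normK ?num_real//.
    have : 0 <= e * (`|A| - 1) ^+ 2 by rewrite mulr_ge0 ?sqr_ge0// ltW.
    lra.
  have : - (e / 2 * (A ^+ 2 + 1)) <= A * negreg P.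
    by move: H; rewrite ler_norml => /andP[].
  nra.
have Pn : P < 0 by rewrite -oppr_gt0.
have gh : 2^-1 <= negreg' P.
  rewrite /negreg' -[leLHS]mul1r ler_wpM2r ?invr_ge0// lerDl oppr_ge0.
  by apply: mulr_le0_ge0; [exact: ltW|rewrite invr_ge0 ltW// sq_gt0].
have Gn : `|negreg P| <= - P.
  have := sq_ge_e P; have := sq_le P; rewrite ltr0_norm// => h1 h2.
  by rewrite ler_norml /negreg -/(sq P); apply/andP; split; lra.
have H : `|A * negreg P| * u <= k / 2 * A ^+ 2 + u ^+ 2 / (2 * k) * (- P) ^+ 2.
  rewrite normrM (le_trans (ler_wpM2r (ltW u0) (ler_wpM2l (normr_ge0 A) Gn)))//.
  rewrite -[A ^+ 2]real_normK ?num_real//; move: (- P) => p.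
  rewrite -subr_ge0.
  have -> : k / 2 * `|A| ^+ 2 + u ^+ 2 / (2 * k) * p ^+ 2 - `|A| * p * u =
    (2 * k)^-1 * (k * `|A| - u * p) ^+ 2 by field; rewrite gt_eqF.
  by rewrite mulr_ge0 ?sqr_ge0// invr_ge0 mulr_ge0// ltW.
have {}H : - (k / 2 * A ^+ 2 + u ^+ 2 / (2 * k) * (- P) ^+ 2) <= u * (A * negreg P).
  rewrite lerNl -mulrN mulrC (le_trans _ H)// ler_wpM2r ?(ltW u0)//.
  by rewrite -normrN ler_norm.
have : k / 2 * A ^+ 2 <= k * negreg' P * A ^+ 2.
  by rewrite ler_wpM2r ?sqr_ge0// ler_wpM2l// ltW.
have : 0 <= u * e / 2 * (A ^+ 2 + 1).
  by rewrite !mulr_ge0 ?invr_ge0 ?(ltW u0) ?(ltW e0)// addr_ge0 ?sqr_ge0.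
lra.
Qed.

End smoothness.

(** * The convection-diffusion operator is quasi-dispersive *)

Lemma L2_sum_ip_ge0 d (T : measurableType d) (R : realType)
    (mu : {measure set T -> \bar R})
    (s : seq (R * (Lp mu (lee1n 2) * Lp mu (lee1n 2)))) :
  {ae mu, forall x, 0 <= \sum_(t <- s) t.1 * (Lp_repr t.2.1 x * Lp_repr t.2.2 x)} ->
  0 <= \sum_(t <- s) t.1 * L2_ip t.2.1 t.2.2.
Proof.
move=> H; pose F (t : R * (Lp mu (lee1n 2) * Lp mu (lee1n 2))) x :=
  t.1 * (Lp_repr t.2.1 x * Lp_repr t.2.2 x).
have iF t : mu.-integrable setT (EFin \o F t).
  by apply: eq_integrable (integrableZl measurableT t.1 (L2_ip_integrable t.2.1 t.2.2)).
have [isum sumE] := Rintegral_sum s measurableT iF.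
have -> : \sum_(t <- s) t.1 * L2_ip t.2.1 t.2.2 = \int[mu]_x (\sum_(t <- s) F t x).
  by rewrite sumE; apply: eq_bigr => t _; rewrite RintegralZl//; exact: L2_ip_integrable.
have msum : measurable_fun setT (fun x => \sum_(t <- s) F t x).
  by apply/measurable_EFinP; have /integrableP[] := isum.
rewrite (@ae_eq_Rintegral _ _ _ _ _ (fun x => `|\sum_(t <- s) F t x|))//.
- by apply: Rintegral_ge0.
- exact: measurableT_comp.
by apply: filterS H => x ?; rewrite ger0_norm.
Qed.

Section dispersive.
Context {R : realType} {m : nat} {Om : set 'rV[R]_m} (oOm : open Om).
Hypothesis bOm : bounded_set Om.
Local Notation mu := (lebesgue_on oOm).
Local Notation L2 := (L2 oOm).
Local Notation ip := (@L2_ip _ _ _ mu).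
Local Notation neg := (@L2_neg _ _ _ mu).

Lemma toL2_ae (f : 'rV[R]_m -> R) : continuous f ->
  {ae mu, forall x, Lp_repr (toL2 oOm f) x = f x}.
Proof. by move=> cf; apply: L2_of_ae; exact: continuous_Lfun2. Qed.

Lemma test_negreg (e : R) (phi : 'rV[R]_m -> R) : 0 < e ->
  test_function Om phi -> test_function Om (negreg e \o phi).
Proof.
move=> e0 [sphi cphi sub].
have supp : closure [set x | (negreg e \o phi) x != 0] `<=`
    closure [set x | phi x != 0].
  apply: closure_subset => x /=; apply: contraNN => /eqP ->.
  by rewrite negreg0.
split; first exact: negreg_smooth.
- by apply: subclosed_compact supp => //; exact: closed_closure.
- exact: subset_trans sub.
Qed.

Lemma weak_deriv_ip i (w w2 : L2) (psi : 'rV[R]_m -> R) :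
  is_weak_deriv i w w2 -> test_function Om psi ->
  ip w (toL2 oOm (pderiv i psi)) = - ip w2 (toL2 oOm psi).
Proof.
move=> wd tpsi; have [spsi _ _] := tpsi.
have E (v : L2) (f : 'rV[R]_m -> R) : continuous f ->
    \int[mu]_x (Lp_repr v x * f x) = ip v (toL2 oOm f).
  move=> cf; apply: ae_eq_Rintegral.
  - apply: measurable_funM; first exact: L2_measurable.
    exact: continuous_measurable_rV.
  - by apply: measurable_funM; exact: L2_measurable.
  by apply: filterS (toL2_ae cf) => x ->.
have [c1 _] := spsi [:: i]; have [c0 _] := spsi [::].
by have := wd psi tpsi; rewrite !E.
Qed.

Lemma dispersive_test i (w w2 : L2) (phi : 'rV[R]_m -> R) (k u eta e : R) :
  0 < k -> 0 < u -> 0 < eta -> 0 < e ->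
  is_weak_deriv i w w2 -> test_function Om phi ->
  k * ip w2 (toL2 oOm (negreg e \o phi)) - u * ip w (toL2 oOm (negreg e \o phi))
  <= k * eta / 2 * `|w| ^+ 2
     + k / (2 * eta) * `|w - toL2 oOm (pderiv i phi)| ^+ 2
     + u ^+ 2 / (2 * k) * `|neg (toL2 oOm phi)| ^+ 2
     + u * e / 2 * (`|w| ^+ 2 + `|toL2 oOm (cst 1)| ^+ 2).
Proof.
move=> k0 u0 eta0 e0 wd tphi; have [sphi _ _] := tphi.
have tpsi := test_negreg e0 tphi; have [spsi _ _] := tpsi.
have [_ _ ip2] := L2_inner_product mu.
have := weak_deriv_ip wd tpsi.
set Theta := toL2 oOm (negreg e \o phi).
set Psi' := toL2 oOm (pderiv i (negreg e \o phi)).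
set D := toL2 oOm (pderiv i phi); set O := toL2 oOm (cst 1).
set N := neg (toL2 oOm phi) => wE.
have := @L2_sum_ip_ge0 _ _ _ mu [:: (k * eta / 2, (w, w));
  (k / (2 * eta), (w - D, w - D)); (u ^+ 2 / (2 * k), (N, N));
  (u * e / 2, (w, w)); (u * e / 2, (O, O)); (k, (w, Psi')); (u, (w, Theta))].
rewrite !big_cons !big_nil /= !ip2 wE => H.
suff : 0 <= k * eta / 2 * `|w| ^+ 2 + (k / (2 * eta) * `|w - D| ^+ 2
    + (u ^+ 2 / (2 * k) * `|N| ^+ 2 + (u * e / 2 * `|w| ^+ 2
    + (u * e / 2 * `|O| ^+ 2 + (k * - ip w2 Theta + (u * ip w Theta + 0)))))).
  move: (k * eta / 2) (k / (2 * eta)) (u ^+ 2 / (2 * k)) (u * e / 2) => a b c d'.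
  lra.
apply: H.
have [c1 _] := sphi [:: i]; have [c0 _] := sphi [::].
have [c2 _] := spsi [:: i]; have [c3 _] := spsi [::].
have cO : continuous (cst 1 : 'rV[R]_m -> R) by exact: cst_continuous.
apply: filterS3 (filterI (toL2_ae c2) (toL2_ae c3))
  (filterI (L2_subE w D) (toL2_ae c1)) (filterI (toL2_ae cO)
  (filterI (toL2_ae c0) (L2_negE (toL2 oOm phi)))).
move=> x [E6 E7] [E1 E2] [E3 [E4 E5]].
rewrite !big_cons !big_nil /= E6 E7 E1 E3 E5 E4 E2.
rewrite [X in k * (_ * X)](_ : _ = pderiv i (negreg e \o phi) x)//.
rewrite pderiv_negreg//.
have := negreg_young e0 (Lp_repr w x) (phi x) (pderiv i phi x) k0 u0 eta0.
rewrite /=; lra.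
Qed.

Lemma negreg_dist (phi : 'rV[R]_m -> R) (z : L2) (e : R) : 0 < e ->
  smooth phi ->
  `|toL2 oOm (negreg e \o phi) + neg z| <=
    2 * (e * `|toL2 oOm (cst 1)| + `|toL2 oOm phi - z|).
Proof.
move=> e0 sphi; have spsi := negreg_smooth sphi e0.
have [c0 _] := sphi [::]; have [c1 _] := spsi [::].
have cO : continuous (cst 1 : 'rV[R]_m -> R) by exact: cst_continuous.
have [_ _ ip2] := L2_inner_product mu.
set Theta := toL2 oOm (negreg e \o phi); set O := toL2 oOm (cst 1).
set D := toL2 oOm phi - z.
have := @L2_sum_ip_ge0 _ _ _ mu [:: (2 * e ^+ 2, (O, O)); (2, (D, D));
  (-1, (Theta + neg z, Theta + neg z))].
rewrite !big_cons !big_nil /= !ip2 => H.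
have {}H : `|Theta + neg z| ^+ 2 <= 2 * e ^+ 2 * `|O| ^+ 2 + 2 * `|D| ^+ 2.
  rewrite -subr_ge0 -addrA -[X in _ + (_ + X)]mulN1r.
  rewrite -[X in _ + (_ + X)]addr0; apply: H.
  apply: filterS3 (filterI (toL2_ae c1) (L2_negE z))
    (filterI (L2_addE Theta (neg z)) (L2_subE (toL2 oOm phi) z))
    (filterI (toL2_ae cO) (toL2_ae c0)).
  move=> x [E1 E2] [E3 E4] [E5 E6].
  rewrite !big_cons !big_nil /= E3 E4 E5 E1 E2 E6 /=.
  have := negreg_close e0 (phi x); set G := negreg e (phi x).
  set a := phi x; set b := Lp_repr z x => Gc.
  have mlip : `|Num.max (- b) 0 - Num.max (- a) 0| <= `|a - b|.
    rewrite ler_norml; case: (leP (- a) 0) => a0; case: (leP (- b) 0) => b0.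
    - by rewrite subrr oppr_le0 normr_ge0.
    - rewrite subr0; have := ler_norm (a - b); move: (`|a - b|) => n.
      by move=> H1; apply/andP; split; lra.
    - rewrite sub0r; have := ler_norm (b - a); rewrite distrC; move: (`|a - b|) => n.
      by move=> H1; apply/andP; split; lra.
    - have := ler_norm (b - a); have := ler_norm (a - b); rewrite (distrC b a).
      by move: (`|a - b|) => n H1 H2; apply/andP; split; lra.
  have : `|G + Num.max (- b) 0| <= e + `|a - b|.
    have -> : G + Num.max (- b) 0 =
      (G + Num.max (- a) 0) + (Num.max (- b) 0 - Num.max (- a) 0) by ring.
    by rewrite (le_trans (ler_normD _ _))// lerD.
  move=> le1; have ab : 0 <= e + `|a - b| by rewrite addr_ge0// ltW.
  have : (G + Num.max (- b) 0) ^+ 2 <= (e + `|a - b|) ^+ 2.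
    by rewrite -[leLHS]real_normK ?num_real// lerXn2r ?nnegrE.
  have : (a - b) ^+ 2 = `|a - b| ^+ 2 by rewrite real_normK// num_real.
  move: (G + _) (a - b) => p q; move: (`|q|) => n qn pn.
  have en : 0 <= (e - n) ^+ 2 by rewrite sqr_ge0.
  rewrite -![_ * p]expr2 -[q * q]expr2 qn; lra.
have r0 : 0 <= e * `|O| + `|D| by rewrite addr_ge0// mulr_ge0// ltW.
rewrite -ler_sqr ?nnegrE ?mulr_ge0//; apply: le_trans H _.
have : 0 <= e * `|O| by rewrite mulr_ge0// ltW.
have : 0 <= `|D| by [].
rewrite -[2 * e ^+ 2 * _]mulrA -exprMn.
move: (e * `|O|) (`|D|) => p q; nra.
Qed.

Lemma dispersive_component i (z w w2 : L2) (phi : nat -> 'rV[R]_m -> R) (k u : R) :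
  0 < k -> 0 < u -> is_weak_deriv i w w2 ->
  (forall n, test_function Om (phi n)) ->
  toL2 oOm (phi n) @[n --> \oo] --> z ->
  toL2 oOm (pderiv i (phi n)) @[n --> \oo] --> w ->
  - (k * ip w2 (neg z) - u * ip w (neg z)) <= u ^+ 2 / (2 * k) * `|neg z| ^+ 2.
Proof.
move=> k0 u0 wd tphi phiz phiw.
have ipP := L2_inner_product mu; have negP := L2_negative_part mu.
have [_ sip _] := ipP.
pose e n : R := n.+1%:R^-1.
have e0 n : 0 < e n by rewrite invr_gt0.
have elim : e n @[n --> \oo] --> (0 : R) by exact: cvg_harmonic.
pose O := toL2 oOm (cst 1).
pose d n := `|w - toL2 oOm (pderiv i (phi n))|.
have d0 n : 0 <= d n by exact: normr_ge0.
have dlim : d n @[n --> \oo] --> (0 : R).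
  rewrite -[X in _ --> X](@normr0 _ L2) -(subrr w).
  by apply: cvg_norm; apply: cvgB => //; exact: cvg_cst.
pose Theta n := toL2 oOm (negreg (e n) \o phi n).
have Tlim : Theta n @[n --> \oo] --> - neg z.
  apply/cvgrPdist_le => eps eps0.
  have lim : 2 * (e n * `|O| + `|toL2 oOm (phi n) - z|) @[n --> \oo] --> (0 : R).
    rewrite -[X in _ --> X](mulr0 (2 : R)); apply: cvgMl_tmp.
    rewrite -[X in _ --> X](addr0 (0 : R)); apply: cvgD.
      by rewrite -[X in _ --> X](mul0r (`|O|)); apply: cvgMr_tmp.
    rewrite -[X in _ --> X](@normr0 _ L2) -(subrr z).
    by apply: cvg_norm; apply: cvgB => //; exact: cvg_cst.
  move/cvgrPdist_le/(_ _ eps0) : lim; apply: filterS => n.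
  rewrite sub0r normrN ger0_norm; last first.
    by rewrite mulr_ge0// addr_ge0// mulr_ge0// ltW.
  apply: le_trans; rewrite -opprD normrN addrC.
  by apply: negreg_dist => //; have [] := tphi n.
have iplim (v : L2) : ip v (Theta n) @[n --> \oo] --> - ip v (neg z).
  rewrite sip -(ipNl ipP) sip; apply/cvgrPdist_le => eps eps0.
  have v0 : 0 < `|v| + 1 by rewrite ltr_wpDl.
  have ev : 0 < eps / (`|v| + 1) by rewrite divr_gt0.
  move/cvgrPdist_le/(_ _ ev) : Tlim; apply: filterS => n.
  rewrite ler_pdivlMr// => Hn.
  rewrite sip [ip v (Theta n)]sip -(ipBl ipP) (le_trans (ip_norm_le ipP _ _))//.
  by rewrite (le_trans _ Hn)// ler_wpM2l// lerDl.
have lhs : k * ip w2 (Theta n) - u * ip w (Theta n) @[n --> \oo] -->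
    - (k * ip w2 (neg z) - u * ip w (neg z)).
  have -> : - (k * ip w2 (neg z) - u * ip w (neg z)) =
    k * - ip w2 (neg z) - u * - ip w (neg z) by ring.
  by apply: cvgB; apply: cvgMl_tmp; exact: iplim.
have rhs : k * (d n + e n) / 2 * `|w| ^+ 2 + k / 2 * d n
    + u ^+ 2 / (2 * k) * (`|neg (toL2 oOm (phi n))| * `|neg (toL2 oOm (phi n))|)
    + u * e n / 2 * (`|w| ^+ 2 + `|O| ^+ 2) @[n --> \oo] -->
    k * (0 + 0) / 2 * `|w| ^+ 2 + k / 2 * 0
    + u ^+ 2 / (2 * k) * (`|neg z| * `|neg z|)
    + u * 0 / 2 * (`|w| ^+ 2 + `|O| ^+ 2).
  have nlim : `|neg (toL2 oOm (phi n))| @[n --> \oo] --> `|neg z|.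
    exact: (neg_norm_cvg ipP negP).
  apply: cvgD; last first.
    by apply: cvgMr_tmp; apply: cvgMr_tmp; apply: cvgMl_tmp; exact: elim.
  apply: cvgD; last by apply: cvgMl_tmp; apply: cvgM; exact: nlim.
  apply: cvgD; last by apply: cvgMl_tmp; exact: dlim.
  apply: cvgMr_tmp; apply: cvgMr_tmp; apply: cvgMl_tmp.
  by apply: cvgD; [exact: dlim|exact: elim].
rewrite (_ : u ^+ 2 / (2 * k) * `|neg z| ^+ 2 =
    k * (0 + 0) / 2 * `|w| ^+ 2 + k / 2 * 0
    + u ^+ 2 / (2 * k) * (`|neg z| * `|neg z|)
    + u * 0 / 2 * (`|w| ^+ 2 + `|O| ^+ 2)); last by rewrite expr2; ring.
apply: (ler_cvg_to lhs rhs); apply: nearW => n.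
have eta0 : 0 < d n + e n by rewrite ltr_wpDl.
apply: le_trans (dispersive_test k0 u0 eta0 (e0 n) wd (tphi n)) _.
rewrite -/(d n) -/O -[`|neg (toL2 oOm (phi n))| * _]expr2.
apply: lerD => //; apply: lerD => //; apply: lerD => //.
have -> : k / (2 * (d n + e n)) * d n ^+ 2 = k / 2 * (d n * (d n / (d n + e n))).
  by field; rewrite gt_eqF.
apply: ler_wpM2l; first by rewrite divr_ge0// ltW.
by rewrite ler_piMr// ler_pdivrMr// mul1r lerDl ltW.
Qed.

End dispersive.

(** * The reaction term and the main theorem *)

Section neg_sums.
Context {R : realType} {V : normedModType R} {ip : V -> V -> R} {neg : V -> V}.
Hypotheses (ipP : inner_product ip) (negP : negative_part ip neg).

Lemma ip_suml (I : Type) (s : seq I) (f : I -> V) z :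
  ip (\sum_(i <- s) f i) z = \sum_(i <- s) ip (f i) z.
Proof.
elim: s => [|i s IH]; first by rewrite !big_nil (ip0l ipP).
by rewrite !big_cons (ipDl ipP) IH.
Qed.

Lemma neg_normZ (a : R) z : 0 <= a -> `|neg (a *: z)| <= a * `|neg z|.
Proof.
move=> a0; have [n1 _] := negP.
have [->|n0] := eqVneq `|neg (a *: z)| 0; first by rewrite mulr_ge0.
have {}n0 : 0 < `|neg (a *: z)| by rewrite lt_def n0/=.
rewrite -(ler_pM2r n0) -expr2 -[leLHS]opprK -n1 (ipZl ipP) -mulrN -mulrA.
by rewrite ler_wpM2l// (neg_ip_le ipP negP).
Qed.

Lemma neg_norm_sum (I : Type) (s : seq I) (f : I -> V) :
  `|neg (\sum_(i <- s) f i)| <= \sum_(i <- s) `|neg (f i)|.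
Proof.
elim: s => [|i s IH].
  by rewrite !big_nil; have := neg_norm_le ipP negP 0; rewrite normr0.
rewrite !big_cons (le_trans (neg_normD ipP negP _ _))// lerD2l.
exact: IH.
Qed.

End neg_sums.

Section L2_of_linear.
Context d (T : measurableType d) (R : realType).
Context {mu : {measure set T -> \bar R}}.

Lemma L2_of_repr (z : Lp mu (lee1n 2)) : L2_of mu (Lp_repr z) = z.
Proof. by apply: L2_ext; exact: (L2_of_ae (L2_repr_fun z)). Qed.

Lemma L2_of_sum (I : Type) (s : seq I) (c : I -> R) (f : I -> T -> R) :
  (forall i, f i \in Lfun mu 2%:R%:E) ->
  L2_of mu (fun x => \sum_(i <- s) c i * f i x) =
  \sum_(i <- s) c i *: L2_of mu (f i).
Proof.
move=> f2.
suff [H ->] : (fun x => \sum_(i <- s) c i * f i x) \in Lfun mu 2%:R%:E /\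
    L2_of mu (fun x => \sum_(i <- s) c i * f i x) =
    \sum_(i <- s) c i *: L2_of mu (f i) by [].
elim: s => [|i s [IH1 IH2]].
  have -> : (fun x => \sum_(i <- [::]) c i * f i x) = cst 0.
    by apply/funext => x; rewrite big_nil.
  have c0 : cst 0 \in Lfun mu 2%:R%:E.
    exact: (@Lfun_addr_closed _ _ _ mu _ (lee1n 2)).1.
  split => //; rewrite big_nil; apply: L2_ext.
  have := L2_scaleE 0 (0 : Lp mu (lee1n 2)); rewrite scale0r.
  by apply: filterS2 (L2_of_ae c0) => x -> ->; rewrite mul0r.
have E : (fun x => \sum_(j <- i :: s) c j * f j x) =
    c i \*o f i + (fun x => \sum_(j <- s) c j * f j x).
  by apply/funext => x; rewrite big_cons.
have ci2 : c i \*o f i \in Lfun mu 2%:R%:E.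
  by have := Lfun_scale (c i) (ler1n R 2) (f2 i); rewrite mul_funC.
have sum2 : (fun x => \sum_(j <- i :: s) c j * f j x) \in Lfun mu 2%:R%:E.
  by rewrite E; exact: (@Lfun_addr_closed _ _ _ mu _ (lee1n 2)).2.
split => //; rewrite big_cons -IH2; apply: L2_ext.
apply: filterS3 (filterI (L2_of_ae sum2) (L2_of_ae IH1))
  (filterI (L2_addE (c i *: L2_of mu (f i))
    (L2_of mu (fun x => \sum_(j <- s) c j * f j x))) (L2_scaleE (c i) (L2_of mu (f i))))
  (L2_of_ae (f2 i)).
by move=> x [-> E1] [-> ->] ->; rewrite big_cons E1.
Qed.

End L2_of_linear.

Section reaction_diffusion.
Context {R : realType} {m s r : nat} {Om : set 'rV[R]_m} (oOm : open Om).
Hypothesis bOm : bounded_set Om.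
Local Notation mu := (lebesgue_on oOm).
Local Notation ip := (@L2_ip _ _ _ mu).
Local Notation neg := (@L2_neg _ _ _ mu).
Local Notation ips := (@hsum_ip R (L2 oOm) s ip).
Local Notation negs := (@hsum_neg R (L2 oOm) s neg).

Lemma opA_dispersive (k u : 'I_m -> R) (z : L2s oOm s) :
  (forall i, 0 < k i) -> (forall i, 0 < u i) -> opA_domain z ->
  - ips (opA k u z) (negs z) <= (\sum_i u i ^+ 2 / (2 * k i)) * `|negs z| ^+ 2.
Proof.
move=> k0 u0 Dz; have ipP := L2_inner_product mu.
rewrite /hsum_ip -sumrN hsum_normsq mulr_sumr; apply: ler_sum => j _.
rewrite !ffunE (ip_suml ipP) -sumrN mulr_suml; apply: ler_sum => i _.
have [[_ [phi [tphi phiz phiw]]] [_ H1w]] := Dz j.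
rewrite (ipBl ipP) !(ipZl ipP).
apply: (dispersive_component bOm (k0 i) (u0 i) _ tphi phiz (phiw i)).
by have [w2 Hw2] := H1w i i; exact: (xgetPex 0 (ex_intro _ w2 Hw2)).
Qed.

Lemma reaction_quasi_positive (l q : 'I_s -> 'I_r -> nat) (h : 'I_r -> R -> R)
    (d : 'I_r -> R) :
  (forall kappa t, 0 <= t -> 0 <= h kappa t <= d kappa) -> condition_H l ->
  exists K, 0 <= K /\ forall t (z : L2s oOm s), 0 <= t ->
    `|negs (reaction l q h t z + (\sum_kappa d kappa) *: z)| <= K * `|negs z|.
Proof.
move=> hd condH; pose lam := \sum_kappa d kappa.
have d0 kappa : 0 <= d kappa.
  by have /andP[h0 h1] := hd kappa 0 (lexx 0); exact: le_trans h1.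
have lam0 : 0 <= lam by exact: sumr_ge0.
have ipP := L2_inner_product mu; have negP := L2_negative_part mu.
pose K := \sum_(j < s) (\sum_kappa (q j kappa)%:R * d kappa + lam).
have K0 : 0 <= K.
  by apply: sumr_ge0 => j _; rewrite addr_ge0// sumr_ge0// => kp _; rewrite mulr_ge0.
exists K; split => // t z t0.
pose g kappa : 'rV[R]_m -> R := fun x => \prod_nu Lp_repr (z nu) x ^+ l nu kappa.
pose E kappa : L2 oOm := toL2 oOm (g kappa).
have one2 : cst 1 \in Lfun mu 2%:R%:E.
  by apply: continuous_Lfun2 => //; exact: cst_continuous.
have gE kappa : (g kappa = cst 1 /\ forall j, l j kappa = 0%N) \/
    exists j0, [/\ g kappa = Lp_repr (z j0) :> (_ -> _), l j0 kappa = 1%N &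
      forall j, j != j0 -> l j kappa = 0%N].
  case: (condH kappa) => [l0|[j0 [[l1 l0] _]]]; [left|right].
    split => //; apply/funext => x; rewrite /g big1// => j _.
    by rewrite l0 expr0.
  exists j0; split => //; apply/funext => x.
  rewrite /g (bigD1 j0)//= l1 expr1 big1 ?mulr1// => j jj0.
  by rewrite l0// expr0.
have g2 kappa : g kappa \in Lfun mu 2%:R%:E.
  by case: (gE kappa) => [[-> _]|[j0 [-> _ _]]] //; exact: L2_repr_fun.
have negE kappa : `|neg (E kappa)| <= `|negs z|.
  rewrite /E; case: (gE kappa) => [[-> _]|[j0 [-> _ _]]].
    rewrite (_ : `|neg _| = 0)//; apply/L2_neg_eq0.
    by apply: filterS (L2_of_ae one2) => x ->.
  rewrite (_ : toL2 _ _ = z j0); last exact: L2_of_repr.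
  by have := hsum_coord_le (negs z) j0; rewrite ffunE.
have lE j kappa : (l j kappa)%:R *: E kappa = (l j kappa)%:R *: z j.
  rewrite /E; case: (gE kappa) => [[_ ->]|[j0 [-> l1 l0]]].
    by rewrite !scale0r.
  have [->|jj0] := eqVneq j j0; last by rewrite l0// !scale0r.
  by congr (_ *: _); exact: L2_of_repr.
have l01 j kappa : (l j kappa <= 1)%N.
  case: (gE kappa) => [[_ ->]|[j0 [_ l1 l0]]] //.
  by have [->|jj0] := eqVneq j j0; [rewrite l1|rewrite l0].
have decomp j : (reaction l q h t z + lam *: z) j =
    \sum_kappa ((q j kappa)%:R * h kappa t) *: E kappa +
    (lam - \sum_kappa (l j kappa)%:R * h kappa t) *: z j.
  rewrite ffunE [X in X + _]ffunE [X in _ + X]ffunE.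
  have -> : toL2 oOm (fun x => \sum_kappa ((q j kappa)%:R - (l j kappa)%:R) *
      h kappa t * \prod_nu Lp_repr (z nu) x ^+ l nu kappa) =
      \sum_kappa (((q j kappa)%:R - (l j kappa)%:R) * h kappa t) *: E kappa.
    exact: L2_of_sum.
  have -> : \sum_kappa
      (((q j kappa)%:R - (l j kappa)%:R) * h kappa t) *: E kappa =
      \sum_kappa ((q j kappa)%:R * h kappa t) *: E kappa -
      (\sum_kappa (l j kappa)%:R * h kappa t) *: z j.
    rewrite scaler_suml -sumrB; apply: eq_bigr => kappa _.
    rewrite mulrBl scalerBl; congr (_ - _).
    by rewrite mulrC -!scalerA lE.
  by rewrite scalerBl addrA addrAC.
have hle j : 0 <= lam - \sum_kappa (l j kappa)%:R * h kappa t <= lam.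
  rewrite subr_ge0 gerBl; apply/andP; split.
    apply: ler_sum => kappa _; have /andP[h0 h1] := hd kappa t t0.
    apply: le_trans h1; rewrite ler_piMl//.
    by rewrite -[leRHS]/(1%:R) ler_nat.
  apply: sumr_ge0 => kappa _; have /andP[h0 h1] := hd kappa t t0.
  exact: mulr_ge0.
apply: le_trans (hsum_norm_le_sum _) _; rewrite /K mulr_suml.
apply: ler_sum => j _; rewrite [X in `|X|]ffunE decomp.
apply: le_trans (neg_normD ipP negP _ _) _; rewrite mulrDl; apply: lerD.
  apply: le_trans (neg_norm_sum ipP negP _ _) _.
  rewrite mulr_suml; apply: ler_sum => kappa _.
  have /andP[h0 h1] := hd kappa t t0.
  apply: le_trans (neg_normZ ipP negP _ _) _; first exact: mulr_ge0.
  by rewrite ler_pM ?mulr_ge0// ler_wpM2l.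
have /andP[c0 c1] := hle j.
apply: le_trans (neg_normZ ipP negP _ c0) _; rewrite ler_pM//.
by have := hsum_coord_le (negs z) j; rewrite ffunE.
Qed.

End reaction_diffusion.

Unset Implicit Arguments.
Set Strict Implicit.
Set Printing Implicit Defensive.

Theorem theorem4p4 (R : realType) (m s r : nat)
    (Om : set 'rV[R]_m) (oOm : open Om)
    (k u : 'I_m -> R) (l q : 'I_s -> 'I_r -> nat) (h : 'I_r -> R -> R)
    (S : R -> L2s oOm s -> L2s oOm s)
    (y0 : L2s oOm s) (y : R -> L2s oOm s) :
  (1 <= m <= 3)%N -> (0 < s)%N -> (0 < r)%N -> bounded_set Om ->
  (forall i, 0 < k i) -> (forall i, 0 < u i) ->
  (forall kappa,
     {ae @lebesgue_measure R, forall t, 0 < t -> {for t, continuous (h kappa)}}) ->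
  (forall kappa, exists2 d : R, 0 < d &
     forall t, 0 <= t -> 0 <= h kappa t <= d) ->
  condition_H l ->
  C0_semigroup S ->
  generates (@opA_domain R m Om oOm s) (opA k u) S ->
  L2s_cone y0 ->
  mild_solution S (reaction l q h) y0 y ->
  forall t, 0 <= t -> L2s_cone (y t).
Proof.
move=> _ _ _ bOm k0 u0 _ hbound condH CS gen cone0 ymild.
have /choice[d Hd] (kappa : 'I_r) : exists d : R,
    forall t, 0 <= t -> 0 <= h kappa t <= d.
  by have [d _ Hd] := hbound kappa; exists d.
have coneE (z : L2s oOm s) : L2s_cone z <->
    `|hsum_neg (@L2_neg _ _ _ (lebesgue_on oOm)) z| = 0.
  split=> [zc|z0 j]; first by apply/hsum_neg_eq0 => j; exact/L2_neg_eq0/zc.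
  by apply/L2_neg_eq0; have /hsum_neg_eq0 := z0; apply.
have ipP := hsum_inner_product (s := s) (L2_inner_product (lebesgue_on oOm)).
have negP := hsum_negative_part (s := s) (L2_negative_part (lebesgue_on oOm)).
have cV : cauchy_complete (L2s oOm s).
  apply: fast_complete_cauchy; apply: hsum_fast_complete.
  exact: L2_fast_complete.
have [K [K0 HK]] := reaction_quasi_positive oOm bOm q Hd condH.
pose C := \sum_i u i ^+ 2 / (2 * k i).
have C0 : 0 <= C.
  by apply: sumr_ge0 => i _; rewrite divr_ge0 ?sqr_ge0// mulr_ge0// ltW.
have Sneg := dispersive_semigroup ipP negP cV CS gen C0
  (fun z Dz => opA_dispersive bOm k0 u0 Dz).
have d0 : 0 <= \sum_kappa d kappa.
  apply: sumr_ge0 => kappa _.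
  by have /andP[h0 h1] := Hd kappa 0 (lexx 0); exact: le_trans h1.
move=> t t0; apply/coneE.
apply: (quasi_positive_invariant ipP negP cV CS ymild _ K0 d0 Sneg _ _ t0).
- by rewrite mulr_ge0.
- by move=> tau z tau0; exact: HK.
- exact/coneE.
Qed.
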